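(* For every $\epsilon>0$ there is an algorithm which, given a unit disk graph $G=(V,E)$ with $n=|V|$ vertices and no isolated vertices, outputs an edge-vertex dominating set of $G$ of cardinality at most $(1+\epsilon)$ times the minimum cardinality of an edge-vertex dominating set of $G$, with running time $n^{O(c^2)}$, where $c=\frac{1}{\epsilon}\log\frac{1}{\epsilon}$. That is, the minimum edge-vertex dominating set problem on unit disk graphs admits a PTAS.
   Context: Graphs are finite, simple and undirected. In a graph $G=(V,E)$, a vertex $v\in V$ is ev-dominated by an edge $e\in E$ if $v$ is an endpoint of $e$ or $v$ is an endpoint of an edge adjacent to $e$ (i.e. sharing a vertex with $e$). A set $S^{ev}\subseteq E$ is an edge-vertex dominating set (EVDS) of $G$ if every vertex of $G$ is ev-dominated by at least one edge of $S^{ev}$. The EVDS problem asks for an EVDS of minimum cardinality. A unit disk graph (UDG) is a graph whose vertices correspond to disks of unit diameter in the plane, two distinct vertices being adjacent if and only if the corresponding disks intersect (equivalently, their centers are at distance at most $1$). *)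

(* Defs.v *)
From mathcomp Require Import all_boot all_order all_algebra.
From mathcomp Require Import all_classical all_reals all_analysis.

Set Implicit Arguments.
Unset Strict Implicit.
Unset Printing Implicit Defensive.

Import Order.TTheory GRing.Theory Num.Theory.

(** A simple graph on the finite type [T] is a symmetric irreflexive relation;
    its edges are the two-element sets of adjacent vertices. *)
Section Graphs.
Variable T : finType.
Implicit Types (e : rel T) (S : {set {set T}}) (d f : {set T}) (v : T).

Definition simple_graph e : Prop := symmetric e /\ irreflexive e.

Definition edges e : {set {set T}} := [set [set u; v] | u in T, v in T & e u v].

Definition no_isolated e : Prop := forall u, exists v, e u v.

Definition adjacent_edges d f : bool := [exists w, (w \in d) && (w \in f)].

Definition ev_dominates e d v : bool :=
  (v \in d) || [exists f in edges e, adjacent_edges d f && (v \in f)].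

Definition evds e S : Prop :=
  S \subset edges e /\ forall v, exists2 d, d \in S & ev_dominates e d v.

Definition minimum_evds e S : Prop :=
  evds e S /\ forall S', evds e S' -> #|S| <= #|S'|.

End Graphs.

Section UnitDiskGraphs.
Local Open Scope ring_scope.
Local Open Scope classical_set_scope.
Variable R : realType.

(* The library norm on [R * R] is the maximum norm, hence this distance. *)
Definition euclidean_dist (x y : R * R) : R :=
  Num.sqrt ((x.1 - y.1) ^+ 2 + (x.2 - y.2) ^+ 2).

Definition unit_diameter_disk (c : R * R) : set (R * R) :=
  [set x | euclidean_dist c x <= 2^-1].

Definition unit_disk_graph (T : finType) (e : rel T) : Prop :=
  exists center : T -> R * R, forall u v : T, u != v ->
    (e u v <->
     unit_diameter_disk (center u) `&` unit_diameter_disk (center v) !=set0).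

End UnitDiskGraphs.

(** Algorithms are structured random access machine programs over finitely many
    unbounded arrays of natural numbers; a scalar variable is cell 0 of an array.
    Every operation has unit cost. The arithmetic is addition and truncated
    subtraction only: with unit-cost multiplication, t steps could produce
    numbers of 2^t bits, and the model would not be polynomially equivalent to
    Turing machines. *)
Inductive expr : Type :=
  | Const of nat
  | Read of nat & expr          (* array name, index *)
  | Add of expr & expr
  | Sub of expr & expr.

Inductive cmd : Type :=
  | Skip
  | Write of nat & expr & expr  (* array name, index, value *)
  | Seq of cmd & cmd
  | If of expr & cmd & cmd      (* a test succeeds when its value is nonzero *)
  | While of expr & cmd.

Definition store : Type := nat -> nat -> nat.

Definition update (s : store) (a i x : nat) : store :=
  fun b j => if (b == a) && (j == i) then x else s b j.

Fixpoint eval (s : store) (x : expr) : nat :=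
  match x with
  | Const k => k
  | Read a i => s a (eval s i)
  | Add x1 x2 => eval s x1 + eval s x2
  | Sub x1 x2 => eval s x1 - eval s x2
  end.

Fixpoint expr_cost (x : expr) : nat :=
  match x with
  | Const _ => 1
  | Read _ i => (expr_cost i).+1
  | Add x1 x2 | Sub x1 x2 => (expr_cost x1 + expr_cost x2).+1
  end.

(** [exec p s t s']: started in store [s], the program [p] halts in store [s']
    after exactly [t] elementary operations. *)
Inductive exec : cmd -> store -> nat -> store -> Prop :=
  | exec_Skip s : exec Skip s 1 s
  | exec_Write s a i x :
      exec (Write a i x) s (expr_cost i + expr_cost x).+1
        (update s a (eval s i) (eval s x))
  | exec_Seq p q s t1 s1 t2 s2 :
      exec p s t1 s1 -> exec q s1 t2 s2 -> exec (Seq p q) s (t1 + t2) s2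
  | exec_IfT b p q s t s1 :
      eval s b != 0 -> exec p s t s1 ->
      exec (If b p q) s (expr_cost b + t).+1 s1
  | exec_IfF b p q s t s1 :
      eval s b = 0 -> exec q s t s1 ->
      exec (If b p q) s (expr_cost b + t).+1 s1
  | exec_WhileF b p s :
      eval s b = 0 -> exec (While b p) s (expr_cost b).+1 s
  | exec_WhileT b p s t1 s1 t2 s2 :
      eval s b != 0 -> exec p s t1 s1 -> exec (While b p) s1 t2 s2 ->
      exec (While b p) s (expr_cost b + t1 + t2).+1 s2.

(** Input: [n] in cell 0 of array 0 and the row-major adjacency matrix in array
    1; all other cells are 0. In particular no disk centers are supplied. *)
Definition input_store (n : nat) (e : rel 'I_n) : store :=
  fun a k =>
    if a == 0 then (if k == 0 then n else 0)
    else if a == 1 then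
      nat_of_bool [exists i : 'I_n, exists j : 'I_n, (k == i * n + j) && e i j]
    else 0.

(** Output: the pairs marked by a nonzero entry of the row-major matrix in
    array 2; only one of the entries (i, j) and (j, i) needs to be marked. *)
Definition output_edges (n : nat) (s : store) : {set {set 'I_n}} :=
  [set [set i; j] | i in 'I_n, j in 'I_n & s 2 (i * n + j) != 0].

(* Main.v *)
Require Import Defs.
From mathcomp Require Import all_boot all_order all_algebra.
From mathcomp Require Import all_classical all_reals all_analysis.
From mathcomp Require Import zify ring lra.
Import Order.TTheory GRing.Theory Num.Theory.
Import numFieldNormedType.Exports.
(* The constructor [Defs.Sub] would otherwise be shadowed by [eqtype.Sub]. *)
Import Defs.

(** An edge [xy] ev-dominates exactly the neighbours of [x] and of [y]. Grow the
    ball around a vertex that is not yet dominated in steps of radius 3, and stop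
    at the first radius [3j] such that the undominated part of the ball of radius
    [3j + 3] can be dominated by at most [1 + 1/k] times the optimum number of
    edges for the undominated part of the ball of radius [3j]. Output such edges
    and discard the larger ball. An edge dominates vertices at distance at most
    3 only, so the inner parts of different rounds need disjoint sets of edges:
    the sum of their optima is a lower bound on any solution.

    If no [j < m] were suitable, the optimum would exceed [(1 + 1/k)^m]; but a
    ball of radius [r] meets at most [(4r + 1)^2] grid squares of side 1/2, each
    of which is a clique, so one edge per square suffices. Hence [m = O(k log k)]
    rounds are enough, and all the tuples to be enumerated have [O(m^2)] edges,
    which costs [n^O((k log k)^2)]. The disk centres only enter this bound. *)

Set Implicit Arguments.
Unset Strict Implicit.
Unset Printing Implicit Defensive.

(** * A for-loop language and its compilation to random access machines *)

(** Loops only run over the [n] vertices, [PFor a p] counting in cell 0 of array [a]. Such programs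
    always halt, so their semantics is a function, and the nesting of loops bounds the exponent of
    the cost. *)
Inductive prog : Type :=
  | PSkip
  | PWrite of nat & expr & expr
  | PSeq of prog & prog
  | PIf of expr & prog & prog
  | PFor of nat & prog.

Notation var a := (Read a (Const 0)).

Fixpoint compile (p : prog) : cmd :=
  match p with
  | PSkip => Skip
  | PWrite a i x => Write a i x
  | PSeq p q => Seq (compile p) (compile q)
  | PIf b p q => If b (compile p) (compile q)
  | PFor a p =>
      Seq (Write a (Const 0) (Const 0))
        (While (Sub (var 0) (var a))
          (Seq (compile p) (Write a (Const 0) (Add (var a) (Const 1)))))
  end.

(** The last update of a loop records the value of the counter when the compiled loop exits, so that
    the final stores agree exactly. *)
Fixpoint run (p : prog) (s : store) : store :=
  match p with
  | PSkip => s
  | PWrite a i x => update s a (eval s i) (eval s x)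
  | PSeq p q => run q (run p s)
  | PIf b p q => if eval s b != 0 then run p s else run q s
  | PFor a p =>
      update (foldl (fun s' i => run p (update s' a 0 i)) s (iota 0 (s 0 0)))
        a 0 (s 0 0)
  end.

Fixpoint writes (p : prog) : seq nat :=
  match p with
  | PSkip => [::]
  | PWrite a _ _ => [:: a]
  | PSeq p q | PIf _ p q => writes p ++ writes q
  | PFor a p => a :: writes p
  end.

(** Neither the loop bound in array 0 nor a running counter is overwritten, so a compiled loop makes
    exactly [n] rounds. *)
Fixpoint wf (p : prog) : bool :=
  match p with
  | PSkip => true
  | PWrite a _ _ => a != 0
  | PSeq p q | PIf _ p q => wf p && wf q
  | PFor a p => [&& a != 0, a \notin writes p & wf p]
  end.

(** The 21 for a loop is 12 for the test and the increment of a round, 3 for the initialisation and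
    6 for the last test. *)
Fixpoint weight (p : prog) : nat :=
  match p with
  | PSkip => 1
  | PWrite _ i x => (expr_cost i + expr_cost x).+1
  | PSeq p q => weight p + weight q
  | PIf b p q => (expr_cost b).+1 + weight p + weight q
  | PFor _ p => weight p + 21
  end.

Fixpoint depth (p : prog) : nat :=
  match p with
  | PSkip | PWrite _ _ _ => 0
  | PSeq p q | PIf _ p q => maxn (depth p) (depth q)
  | PFor _ p => (depth p).+1
  end.

Lemma update_same s a i x : update s a i x a i = x.
Proof. by rewrite /update !eqxx. Qed.

Lemma update_other s a i x b : b != a -> update s a i x b = s b.
Proof. by move=> /negbTE ba; apply/funext => j; rewrite /update ba. Qed.

Lemma run_frame p s a : a \notin writes p -> run p s a = s a.
Proof.
elim: p s => [|b i x|p IHp q IHq|b p IHp q IHq|b p IHp] s //=.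
- by rewrite inE => ab; rewrite update_other.
- by rewrite mem_cat negb_or => /andP[ap aq]; rewrite IHq ?IHp.
- by rewrite mem_cat negb_or => /andP[ap aq]; case: ifP; rewrite ?IHq ?IHp.
- rewrite inE negb_or => /andP[ab ap]; rewrite update_other //.
  move: (iota _ _) => l; elim: l s => //= i l IHl s.
  by rewrite IHl IHp // update_other.
Qed.

Lemma wf_writes0 p : wf p -> 0 \notin writes p.
Proof.
elim: p => [|a i x|p IHp q IHq|b p IHp q IHq|a p IHp] //=.
- by rewrite inE eq_sym.
- by move=> /andP[/IHp hp /IHq hq]; rewrite mem_cat negb_or hp.
- by move=> /andP[/IHp hp /IHq hq]; rewrite mem_cat negb_or hp.
- by move=> /and3P[a0 _ /IHp hp]; rewrite inE negb_or eq_sym a0.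
Qed.

(** Each round may assume that arrays which the loop does not write are still as in [s], so
    invariants need not repeat this. The exit value of the counter is set only in the passage to
    [Q]. *)
Lemma for_ind a p s (I : nat -> store -> Prop) (Q : store -> Prop) :
  I 0 s ->
  (forall i s', i < s 0 0 -> (forall b, b \notin a :: writes p -> s' b = s b) ->
    I i s' -> I i.+1 (run p (update s' a 0 i))) ->
  (forall s', (forall b, b \notin a :: writes p -> s' b = s b) ->
    I (s 0 0) s' -> Q (update s' a 0 (s 0 0))) ->
  Q (run (PFor a p) s).
Proof.
move=> I0 IS IQ /=.
have main k : k <= s 0 0 ->
    let s' := foldl (fun s' i => run p (update s' a 0 i)) s (iota 0 k) in
    (forall b, b \notin a :: writes p -> s' b = s b) /\ I k s'.
  elim: k => [|k IHk] klt; first by [].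
  rewrite -addn1 iotaD foldl_cat /= add0n addn1.
  have [frame Ik] := IHk (ltnW klt).
  split=> [b bp|]; last exact: IS.
  move: (bp); rewrite inE negb_or => /andP[ba bp'].
  by rewrite run_frame // update_other // frame.
by have [frame In] := main _ (leqnn _); apply: IQ.
Qed.

(** Each level of nesting contributes one factor [N]; since [N] is positive, the overhead of a loop
    is absorbed into its weight. *)
Lemma compileP N p s : wf p -> s 0 0 <= N -> 0 < N ->
  exists2 t, t <= weight p * N ^ depth p & exec (compile p) s t (run p s).
Proof.
move=> + + N0; elim: p s => [|a i x|p IHp q IHq|b p IHp q IHq|a p IHp] s /=.
- by exists 1 => //; constructor.
- by exists (expr_cost i + expr_cost x).+1; [rewrite expn0 muln1|constructor].
- move=> /andP[wp wq] sN.
  have [t1 t1le e1] := IHp _ wp sN.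
  have [|t2 t2le e2] := IHq (run p s) wq; first by rewrite run_frame ?wf_writes0.
  exists (t1 + t2); last exact: exec_Seq e1 e2.
  rewrite mulnDl leq_add //.
    by apply: leq_trans t1le _; rewrite leq_mul2l leq_pexp2l ?leq_maxl ?orbT.
  by apply: leq_trans t2le _; rewrite leq_mul2l leq_pexp2l ?leq_maxr ?orbT.
- move=> /andP[wp wq] sN.
  have NM : 0 < N ^ maxn (depth p) (depth q) by rewrite expn_gt0 N0.
  case: eqP => /= [b0|/eqP b0].
  + have [t tle et] := IHq _ wq sN.
    exists (expr_cost b + t).+1; last exact: exec_IfF.
    rewrite -addSn !mulnDl -addnA leq_add ?leq_pmulr //.
    apply: leq_trans (leq_addl _ _).
    by apply: leq_trans tle _; rewrite leq_mul2l leq_pexp2l ?leq_maxr ?orbT.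
  + have [t tle et] := IHp _ wp sN.
    exists (expr_cost b + t).+1; last exact: exec_IfT.
    rewrite -addSn !mulnDl -addnA leq_add ?leq_pmulr //.
    apply: leq_trans (leq_addr _ _).
    by apply: leq_trans tle _; rewrite leq_mul2l leq_pexp2l ?leq_maxl ?orbT.
- move=> /and3P[a0 ap wp] sN; set n := s 0 0.
  set F := foldl _ _; set B := weight p * N ^ depth p.
  have FS k : F (iota 0 k.+1) = run p (update (F (iota 0 k)) a 0 k).
    by rewrite /F -addn1 iotaD foldl_cat.
  have F00 k : F (iota 0 k) 0 0 = n.
    rewrite /F; elim: k => [|k IHk] //.
    rewrite -/F FS run_frame ?wf_writes0 //.
    by rewrite update_other // eq_sym.
  (* [k] counts the rounds still to go, because the semantics of a while loop unfolds its first
     round. *)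
  have loop k : k <= n -> exists2 t, t <= k * (B + 12) + 6 &
      exec (While (Sub (var 0) (var a))
              (Seq (compile p) (Write a (Const 0) (Add (var a) (Const 1)))))
        (update (F (iota 0 (n - k))) a 0 (n - k)) t (update (F (iota 0 n)) a 0 n).
    elim: k => [|k IHk] kn.
      rewrite subn0; exists 6 => //.
      apply: (@exec_WhileF (Sub (var 0) (var a))) => /=.
      by rewrite update_same update_other 1?eq_sym // F00 subnn.
    have [t tle et] := IHk (ltnW kn).
    set i := n - k.+1; have iE : n - k = i.+1 by rewrite /i; lia.
    have := IHp (update (F (iota 0 i)) a 0 i) wp.
    rewrite update_other 1?eq_sym // F00 => /(_ sN)[t1 t1le e1].
    exists (5 + (t1 + 6) + t).+1; first by rewrite -/B in t1le; lia.
    apply: (@exec_WhileT (Sub (var 0) (var a))) => /=.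
    + by rewrite update_same update_other 1?eq_sym // F00 /i; lia.
    + apply: exec_Seq e1 _; exact: exec_Write.
    + by move: et; rewrite iE FS /= run_frame // update_same addn1.
  have [t tle et] := loop n (leqnn n).
  exists (3 + t).
    have h1 : n * (B + 12) <= N * (B + 12) by rewrite leq_mul2r sN orbT.
    have h2 : 0 < N ^ depth p by rewrite expn_gt0 N0.
    rewrite expnS /B in h1 tle *; nia.
  by apply: exec_Seq (exec_Write _ _ _ _) _; move: et; rewrite subnn.
Qed.

(** * Edge-vertex domination and balls in graphs *)

Section Domination.
Variables (T : finType) (e : rel T).
Hypotheses (e_simple : simple_graph e) (e_no_isolated : no_isolated e).
Implicit Types (u v w x y : T) (A S U X : {set T}) (F : {set {set T}}).

Let e_sym : symmetric e := proj1 e_simple.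

Definition pair_dominates (p : T * T) u : bool := e p.1 u || e p.2 u.

Lemma edgeP (f : {set T}) :
  reflect (exists2 p : T * T, e p.1 p.2 & f = [set p.1; p.2]) (f \in edges e).
Proof.
apply: (iffP imset2P) => [[x y _]|[[x y] exy ->]].
  by rewrite inE /= => exy ->; exists (x, y).
by exists x y; rewrite ?inE.
Qed.

(** Each end of the edge is a neighbour of the other end, so the clause about endpoints is absorbed
    and domination becomes a test of two matrix entries. *)
Lemma ev_dominatesE x y u :
  e x y -> ev_dominates e [set x; y] u = pair_dominates (x, y) u.
Proof.
move=> exy; apply/orP/orP => /= [[]|]; last first.
- move=> exyu; right; apply/existsP.
  have [z zxy ezu] : exists2 z, z \in [set x; y] & e z u.
    by case: exyu; [exists x|exists y]; rewrite ?in_set2 ?eqxx ?orbT.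
  exists [set z; u]; apply/and3P; split.
  + by apply/edgeP; exists (z, u).
  + by apply/existsP; exists z; rewrite zxy in_set2 eqxx.
  + by rewrite in_set2 eqxx orbT.
- case/existsP=> f /and3P[/edgeP[[a b] /= eab ->] /existsP[w /andP[wxy wab]] uab].
  have [->|uw] := eqVneq u w.
    move: wxy; rewrite in_set2 => /orP[]/eqP->; last by left.
    by right; rewrite e_sym.
  have ewu : e w u.
    move: wab uab uw; rewrite !in_set2.
    by case/orP=> /eqP->; case/orP=> /eqP->; rewrite ?eqxx // e_sym.
  by move: wxy; rewrite in_set2 => /orP[]/eqP <-; [left|right].
- by rewrite in_set2 => /orP[]/eqP->; [right; rewrite e_sym|left].
Qed.

Fixpoint ball v (r : nat) : {set T} :=
  if r is r'.+1 then
    [set w | (w \in ball v r') || [exists u in ball v r', e u w]]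
  else [set v].

Arguments ball : simpl never.

Lemma in_ballS v r w :
  (w \in ball v r.+1) = (w \in ball v r) || [exists u in ball v r, e u w].
Proof. by rewrite /ball inE. Qed.

Lemma ball_center v r : v \in ball v r.
Proof. by elim: r => [|r IHr]; rewrite ?in_ballS ?IHr // /ball inE. Qed.

Lemma ball_widen v r u : u \in ball v r -> u \in ball v r.+1.
Proof. by rewrite in_ballS => ->. Qed.

Lemma ball_mono v r r' : r <= r' -> ball v r \subset ball v r'.
Proof.
move=> /subnK <-; elim: (r' - r) => [|d IHd]; first by rewrite add0n.
by rewrite addSn; apply/fintype.subsetP => u /(fintype.subsetP IHd); exact: ball_widen.
Qed.

Lemma ball_step v r u w : u \in ball v r -> e u w -> w \in ball v r.+1.
Proof.
by move=> ur euw; rewrite in_ballS; apply/orP; right; apply/existsP; exists u; rewrite ur.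
Qed.

(** There is a walk from [u] to an end of the edge, possibly along the edge, and on to [w]: at most
    three steps. *)
Lemma ball_ev_dominates v r u w f : f \in edges e -> u \in ball v r ->
  ev_dominates e f u -> ev_dominates e f w -> w \in ball v r.+3.
Proof.
move=> /edgeP[[x y] /= exy ->] ur; rewrite !ev_dominatesE //.
have eyx : e y x by rewrite e_sym.
rewrite /pair_dominates /= ![e _ u]e_sym => /orP[] eu /orP[] ew.
- by apply/ball_widen/(ball_step _ ew)/(ball_step ur).
- by apply: ball_step ew; apply: ball_step exy; apply: ball_step eu.
- by apply: ball_step ew; apply: ball_step eyx; apply: ball_step eu.
- by apply/ball_widen/(ball_step _ ew)/(ball_step ur).
Qed.

(** * Covering by few edges, and lower bounds by packing *)

Definition covers (t : nat -> T * T) (q : nat) A : Prop :=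
  forall a, a \in A -> exists2 i, i < q & pair_dominates (t i) a.

(** Sequences may repeat edges, as the enumerated tuples do, so [q] only bounds the number of
    distinct edges. *)
Definition dom (q : nat) A : Prop :=
  exists2 t, (forall i, i < q -> e (t i).1 (t i).2) & covers t q A.

Lemma dom_leq q q' v A : q <= q' -> dom q A -> dom q' A.
Proof.
move=> qq' [t te tA]; have [w evw] := e_no_isolated v.
exists (fun i => if i < q then t i else (v, w))=> [i _|a /tA[i iq ia]].
  by case: ifP => [/te|].
by exists i; [exact: leq_trans qq'|rewrite iq].
Qed.

Lemma dom_edge_set F v A : F \subset edges e ->
  (forall a, a \in A -> exists2 f, f \in F & ev_dominates e f a) -> dom #|F| A.
Proof.
move=> Fe FA.
pose ends f := odflt (v, v) [pick p : T * T | e p.1 p.2 && (f == [set p.1; p.2])].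
have endsP f : f \in F -> e (ends f).1 (ends f).2 /\ f = [set (ends f).1; (ends f).2].
  move=> /(fintype.subsetP Fe)/edgeP[p ep ->]; rewrite /ends.
  case: pickP => [p' /andP[ep' /eqP ->] //|/(_ p)].
  by rewrite ep eqxx.
exists (fun i => ends (nth finset.set0 (enum F) i))=> [i iF|a /FA[f fF fa]].
  have /endsP[] // : nth finset.set0 (enum F) i \in F.
  by rewrite -mem_enum mem_nth // -cardE.
exists (index f (enum F)); first by rewrite cardE index_mem mem_enum.
rewrite nth_index ?mem_enum //; have [ef fE] := endsP f fF.
by move: fa; rewrite {1}fE ev_dominatesE //; case: (ends f).
Qed.

(** A certificate for the lower bound: [U] collects the inner parts of past rounds, [N] is the sum
    of the lower bounds for them, and [X] contains all that an edge reaching [U] can dominate.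
    Vertices outside [X] therefore need further edges. *)
Definition packing U (N : nat) X : Prop :=
  (forall F, F \subset edges e ->
    (forall u, u \in U -> exists2 f, f \in F & ev_dominates e f u) -> N <= #|F|) /\
  (forall u f w, u \in U -> f \in edges e -> ev_dominates e f u ->
    ev_dominates e f w -> w \in X).

Lemma packing0 X : packing finset.set0 0 X.
Proof. by split=> // u f w; rewrite inE. Qed.

(* No edge dominates both a vertex of [U] and a vertex of [S], so the edges that
   dominate [U] and those that dominate [S] can be counted separately. *)
Lemma packing_step U N X v r S q : packing U N X ->
  S \subset ball v r :\: X -> 0 < q -> ~ dom q.-1 S ->
  packing (U :|: S) (N + q) (X :|: ball v r.+3).
Proof.
move=> [UN UX] /fintype.subsetP SX q0 Sq; split=> [F Fe FUS|u f w]; last first.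
  rewrite !finset.in_setU => /orP[uU|/SX uS] fe fu fw.
    by rewrite (UX u f).
  move: uS; rewrite finset.in_setD => /andP[_ ur].
  by rewrite (ball_ev_dominates fe ur) ?orbT.
pose G := [set f in F | [exists u in U, ev_dominates e f u]].
pose H := [set f in F | [exists u in S, ev_dominates e f u]].
have GF : G \subset F by apply/fintype.subsetP => f; rewrite inE => /andP[].
have HF : H \subset F by apply/fintype.subsetP => f; rewrite inE => /andP[].
have NG : N <= #|G|.
  apply: UN => [|u uU]; first exact: fintype.subset_trans Fe.
  have [|f fF fu] := FUS u; first by rewrite inE uU.
  by exists f => //; rewrite inE fF; apply/existsP; exists u; rewrite uU.
(* Fewer than [q] edges in [H] could be padded to [q.-1] edges, and these do not suffice for [S]. *)
have qH : q <= #|H|.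
  rewrite leqNgt; apply/negP => Hq; apply: Sq.
  apply: (@dom_leq #|H| _ v); first by rewrite -ltnS prednK.
  apply: dom_edge_set => //; first exact: fintype.subset_trans Fe.
  move=> s sS; have [|f fF fs] := FUS s; first by rewrite inE sS orbT.
  by exists f => //; rewrite inE fF; apply/existsP; exists s; rewrite sS.
have GH : [disjoint G & H].
  apply/fintype.pred0P => f /=; apply/negP => /andP[]; rewrite !inE.
  move=> /andP[fF /existsP[u /andP[uU fu]]] /andP[_ /existsP[s /andP[sS fs]]].
  move/SX: sS; rewrite finset.in_setD (UX u f) //.
  exact: (fintype.subsetP Fe).
rewrite (leq_trans (leq_add NG qH)) // -cardsUI.
rewrite (_ : G :&: H = finset.set0) ?cards0 ?addn0; last first.
  by apply/eqP; rewrite setI_eq0.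
by apply: subset_leq_card; rewrite finset.subUset GF HF.
Qed.

(** If no stage were suitable, the least number of edges would grow by a factor above [1 + 1/k] at
    every stage; starting from at least 1, it would exceed [K] after [m] stages. *)
Lemma dom_growth (A : nat -> {set T}) v k m K : v \in A 0 ->
  (forall j, j <= m -> dom K (A j)) -> 0 < k -> K * k ^ m < k.+1 ^ m ->
  exists j q, [/\ j < m, 0 < q <= K, ~ dom q.-1 (A j)
                & dom (k.+1 * q %/ k) (A j.+1)].
Proof.
move=> vA AK k0 Kkm; apply: contrapT => none.
suff low j : j <= m -> forall q, dom q (A j) -> k.+1 ^ j <= q * k ^ j.
  by have := low m (leqnn m) K (AK m (leqnn m)); rewrite leqNgt Kkm.
elim: j => [|j IHj] jm q dq.
  case: q dq => [|q] // [t _ /(_ v vA)[]] //.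
(* [q0] is the optimum at stage [j], so [q0.-1] edges fail there. *)
have [q0 dq0 q0min] : exists2 q0, dom q0 (A j) & forall q, dom q (A j) -> q0 <= q.
  have ex : exists q, `[< dom q (A j) >] by exists K; apply/asboolP/AK/ltnW.
  case: (ex_minnP ex) => q0 /asboolP dq0 min; exists q0 => // q' dq'.
  by apply: min; apply/asboolP.
have low0 := IHj (ltnW jm) _ dq0.
have q0_gt0 : 0 < q0.
  by move: low0; case: (q0) => //; rewrite mul0n leqNgt expn_gt0.
(* Stage [j] is not suitable with [q0], so every [q] that suffices for the next stage exceeds the
   quotient. *)
have q0q : k.+1 * q0 < q * k.
  rewrite -ltn_divLR // ltnNge; apply/negP => qle; apply: none.
  exists j, q0; split=> //.
  - by rewrite q0_gt0 q0min //; apply/AK/ltnW.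
  - by move=> /q0min; rewrite leqNgt prednK // leqnn.
  - exact: dom_leq dq.
rewrite !expnS mulnA (leq_trans (leq_mul (leqnn _) low0)) //.
by rewrite mulnA leq_mul2r ltnW ?orbT.
Qed.

(** An edge at a representative of a cell dominates the representative through its other end, and
    the rest of the cell because the cell is a clique. *)
Lemma dom_cells (M : nat) (A : {set T}) v (cell : T -> nat * nat) :
  (forall a, a \in A -> ((cell a).1 < M) && ((cell a).2 < M)) ->
  (forall a b, a \in A -> b \in A -> cell a = cell b -> a != b -> e a b) ->
  dom (M ^ 2) A.
Proof.
move=> cellM cellP.
have nbr u : {w | e u w} by apply/cid/e_no_isolated.
(* Cells are numbered in base [M]; an empty cell falls back on [v], only to have some edge. *)
pose rep i := odflt v [pick a in A | (cell a).1 * M + (cell a).2 == i].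
exists (fun i => (rep i, sval (nbr (rep i)))) => [i _|a aA] /=.
  exact: svalP (nbr _).
have /andP[a1 a2] := cellM a aA.
exists ((cell a).1 * M + (cell a).2).
  by rewrite -mulnn; nia.
rewrite /pair_dominates /=; set b := rep _.
have [bA ab] : b \in A /\ cell b = cell a.
  rewrite /b /rep; case: pickP => [c /andP[cA /eqP cE]|/(_ a)]; last by rewrite aA eqxx.
  split=> //; have /andP[c1 c2] := cellM c cA.
  have M0 : 0 < M by apply: leq_trans a1.
  have E1 : (cell c).1 = (cell a).1.
    by have := congr1 (divn^~ M) cE; rewrite !divnMDl // !divn_small // !addn0.
  have E2 : (cell c).2 = (cell a).2 by move: cE; rewrite E1 => /addnI.
  by move: E1 E2; case: (cell c) (cell a) => ? ? [? ?] /= -> ->.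
case: (eqVneq b a) => [<-|ba]; last by rewrite cellP.
by rewrite e_sym (svalP (nbr b)) orbT.
Qed.

End Domination.

(** * Balls in unit disk graphs *)

Section UnitDisks.
Local Open Scope ring_scope.
Variables (R : realType) (T : finType) (e : rel T).
Implicit Types (c x y : R * R).

Lemma euclidean_dist_coord x y r : 0 <= r -> euclidean_dist x y <= r ->
  `|x.1 - y.1| <= r /\ `|x.2 - y.2| <= r.
Proof.
move=> r0 xyr.
have h : (x.1 - y.1) ^+ 2 + (x.2 - y.2) ^+ 2 <= r ^+ 2.
  have s0 : 0 <= (x.1 - y.1) ^+ 2 + (x.2 - y.2) ^+ 2 by rewrite addr_ge0 ?sqr_ge0.
  by rewrite -(sqr_sqrtr s0) ler_sqr ?nnegrE ?sqrtr_ge0.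
have h1 : 0 <= (x.1 - y.1) ^+ 2 by rewrite sqr_ge0.
have h2 : 0 <= (x.2 - y.2) ^+ 2 by rewrite sqr_ge0.
by split; rewrite -ler_sqr ?nnegrE ?normr_ge0 // real_normK ?num_real //; lra.
Qed.

Definition udg_centers (p : T -> R * R) : Prop := forall u v, u != v ->
  (e u v <-> (unit_diameter_disk (p u) `&` unit_diameter_disk (p v) !=set0)%classic).

Lemma udg_edge_coord p u v : udg_centers p -> irreflexive e -> e u v ->
  `|(p u).1 - (p v).1| <= 1 /\ `|(p u).2 - (p v).2| <= 1.
Proof.
move=> pP eirr euv.
have uv : u != v by apply/eqP => uv; rewrite uv eirr in euv.
have /(pP u v uv)[z [/= uz vz]] := euv.
have h0 : 0 <= 2^-1 :> R by lra.
have [u1 u2] := euclidean_dist_coord h0 uz.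
have [v1 v2] := euclidean_dist_coord h0 vz.
move: u1 u2 v1 v2; rewrite !ler_norml => /andP[? ?] /andP[? ?] /andP[? ?] /andP[? ?].
by split; apply/andP; split; lra.
Qed.

(** The midpoint of the centres lies in both disks: its offset from either is at most 1/4 in each
    coordinate, and the square root of 1/8 is below 1/2. *)
Lemma udg_close_edge p u v : udg_centers p -> u != v ->
  `|(p u).1 - (p v).1| <= 2^-1 -> `|(p u).2 - (p v).2| <= 2^-1 -> e u v.
Proof.
move=> pP uv; rewrite !ler_norml => /andP[a1 a2] /andP[b1 b2].
apply/(pP u v uv).
exists (((p u).1 + (p v).1) / 2, ((p u).2 + (p v).2) / 2).
have sq (a : R) : - 2^-1 <= a -> a <= 2^-1 -> (a / 2) ^+ 2 <= 16^-1.
  move=> la ua; have : 0 <= (2^-1 - a) * (2^-1 + a) by apply: mulr_ge0; lra.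
  by rewrite expr2; lra.
have dist_le a b : a ^+ 2 <= 16^-1 -> b ^+ 2 <= 16^-1 ->
    Num.sqrt (a ^+ 2 + b ^+ 2) <= 2^-1 :> R.
  move=> a16 b16; have h0 : 0 <= 2^-1 :> R by lra.
  rewrite -(ger0_norm h0) -sqrtr_sqr ler_wsqrtr //.
  by rewrite (le_trans (lerD a16 b16)) // expr2; lra.
split; rewrite /unit_diameter_disk /euclidean_dist /=.
- set a := (X in X ^+ 2 + _); set b := (X in _ + X ^+ 2).
  have -> : a = ((p u).1 - (p v).1) / 2 by rewrite /a; field.
  have -> : b = ((p u).2 - (p v).2) / 2 by rewrite /b; field.
  by apply: dist_le; apply: sq; lra.
- set a := (X in X ^+ 2 + _); set b := (X in _ + X ^+ 2).
  have -> : a = ((p v).1 - (p u).1) / 2 by rewrite /a; field.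
  have -> : b = ((p v).2 - (p u).2) / 2 by rewrite /b; field.
  by apply: dist_le; apply: sq; lra.
Qed.

Lemma udg_ball_coord p v r u : udg_centers p -> irreflexive e -> u \in ball e v r ->
  `|(p u).1 - (p v).1| <= r%:R /\ `|(p u).2 - (p v).2| <= r%:R.
Proof.
move=> pP eirr; elim: r u => [|r IHr] u.
  by rewrite /ball inE => /eqP ->; rewrite !subrr normr0.
rewrite in_ballS -natr1 => /orP[/IHr[h1 h2]|/existsP[w /andP[/IHr[h1 h2]]]].
  by split; [apply: le_trans h1 _|apply: le_trans h2 _]; lra.
move=> /(udg_edge_coord pP eirr)[].
move: h1 h2; rewrite !ler_norml => /andP[? ?] /andP[? ?] /andP[? ?] /andP[? ?].
by split; apply/andP; split; lra.
Qed.

(** Intervals of length 1/2, numbered from [-r]; the endpoint [z = r] accounts for the last of the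
    [4r + 1] indices. *)
Definition half_cell (r : nat) (z : R) : nat := Num.truncn (2 * (z + r%:R)).

Lemma half_cell_lt r z : `|z| <= r%:R -> (half_cell r z < (4 * r).+1)%N.
Proof.
rewrite ler_norml => /andP[z1 z2]; rewrite /half_cell ltnS truncn_le_nat.
by rewrite -(natr1 (4 * r)%N) natrM; lra.
Qed.

Lemma half_cell_eq r z z' : `|z| <= r%:R -> `|z'| <= r%:R ->
  half_cell r z = half_cell r z' -> `|z - z'| <= 2^-1.
Proof.
rewrite !ler_norml /half_cell => /andP[z1 z2] /andP[z1' z2'] zz'.
have h : 0 <= 2 * (z + r%:R) by lra.
have h' : 0 <= 2 * (z' + r%:R) by lra.
move: (truncn_itv h) (truncn_itv h'); rewrite zz'; set t := Num.truncn _; rewrite -(natr1 t).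
by move=> /andP[? ?] /andP[? ?]; apply/andP; split; lra.
Qed.

(* The squares of side 1/2 have diameter less than 1, so the vertices of a cell
   are pairwise adjacent and one edge at any of them dominates all of them. *)
Lemma udg_ball_dom v r : simple_graph e -> no_isolated e -> unit_disk_graph R e ->
  dom e ((4 * r).+1 ^ 2) (ball e v r).
Proof.
move=> e_simple e_iso [p pP]; have [_ eirr] := e_simple.
pose cell u := (half_cell r ((p u).1 - (p v).1), half_cell r ((p u).2 - (p v).2)).
apply: (@dom_cells _ _ e_simple e_iso _ _ v cell) => [a ar|a b ar br [ab1 ab2] ab].
  by have [h1 h2] := udg_ball_coord pP eirr ar; rewrite !half_cell_lt.
have [a1 a2] := udg_ball_coord pP eirr ar.
have [b1 b2] := udg_ball_coord pP eirr br.
have := half_cell_eq a1 b1 ab1; have := half_cell_eq a2 b2 ab2.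
move=> h2 h1.
by apply: (udg_close_edge pP ab); [move: h1|move: h2]; congr (`|_| <= _); ring.
Qed.

End UnitDisks.

(** * The program and its correctness *)

Lemma run_if b p q s :
  run (PIf b p q) s = if eval s b != 0 then run p s else run q s.
Proof. by []. Qed.

Lemma run_seq p q s : run (PSeq p q) s = run q (run p s).
Proof. by []. Qed.

Lemma for_preserve a p s (J : store -> Prop) : J s ->
  (forall i s', i < s 0 0 -> J s' -> J (run p (update s' a 0 i))) ->
  (forall s', J s' -> J (update s' a 0 (s 0 0))) -> J (run (PFor a p) s).
Proof.
move=> Js Jp Ja; apply: (for_ind (I := fun=> J)) => //.
- by move=> i s' ilt _; apply: Jp.
- by move=> s' _; apply: Ja.
Qed.

(** The rule for searches: round [i0] establishes [G] from the invariant [J] alone, and no later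
    round destroys it. *)
Lemma for_reach a p s (J G : store -> Prop) i0 : i0 < s 0 0 -> J s ->
  (forall i s', i < s 0 0 -> J s' -> J (run p (update s' a 0 i))) ->
  (forall s', J s' -> G (run p (update s' a 0 i0))) ->
  (forall i s', i < s 0 0 -> J s' -> G s' -> G (run p (update s' a 0 i))) ->
  (forall s', J s' -> G s' -> G (update s' a 0 (s 0 0))) -> G (run (PFor a p) s).
Proof.
move=> i0n Js Jp G0 Gp Ga.
apply: (for_ind (I := fun i s' => J s' /\ (i0 < i -> G s'))) => //.
- move=> i s' ilt _ [Js' Gs']; split=> [|]; first exact: Jp.
  by rewrite ltnS leq_eqVlt => /orP[/eqP <-|/Gs'] //; [apply: G0|apply: Gp].
- by move=> s' _ [Js' Gs']; apply: Ga => //; apply: Gs'.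
Qed.

(* Arrays: 0 to 2 are the input and the output; cell i of 3 holds i * n, with
   accumulator 4; 5 marks the dominated vertices; 6 is the centre v of the
   current ball, and 7 holds R + 1 - d(v, u) if d(v, u) <= R and 0 otherwise;
   8 and 9 are loop variables; 10 to 12 are flags; 13 + 2i and 14 + 2i are the
   ends of the i-th edge of the current tuple. *)
Definition adj (x y : expr) : expr := Read 1 (Add (Read 3 x) y).

Definition src (i : nat) : nat := 13 + i.*2.
Definition dst (i : nat) : nat := 14 + i.*2.

(** Truncated subtraction serves as a comparison: the value is nonzero when the label exceeds
    [R - r], that is, when the distance is at most [r]. *)
Definition within (R r : nat) (u : expr) : expr :=
  Sub (Read 7 u) (Const (R - r)).

(** The machine cannot multiply, so the row offsets arise as running sums. *)
Definition offsets : prog :=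
  PFor 6 (PSeq (PWrite 3 (var 6) (var 4))
               (PWrite 4 (Const 0) (Add (var 4) (var 0)))).

(** Labels written in round [l] equal [R - l], too small for the test [within R l]; hence the round
    can work in place and still advances by one step only. *)
Definition bfs_step (R l : nat) : prog :=
  PFor 8 (PFor 9 (PIf (within R l (var 8))
    (PIf (adj (var 8) (var 9))
      (PIf (Read 7 (var 9)) PSkip (PWrite 7 (var 9) (Const (R - l))))
      PSkip) PSkip)).

Fixpoint bfs_steps (R l : nat) : prog :=
  if l is l'.+1 then PSeq (bfs_steps R l') (bfs_step R l') else PSkip.

Definition bfs (R : nat) : prog :=
  PSeq (PFor 8 (PWrite 7 (var 8) (Const 0)))
    (PSeq (PWrite 7 (var 6) (Const R.+1)) (bfs_steps R R)).

(** A sum of adjacency bits serves as a disjunction: it is nonzero when one of the [q] edges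
    dominates [u]. *)
Fixpoint cover_count (q : nat) (u : expr) : expr :=
  if q is q'.+1 then
    Add (Add (adj (var (src q')) u) (adj (var (dst q')) u)) (cover_count q' u)
  else Const 0.

Definition check (R r q : nat) : prog :=
  PSeq (PWrite 12 (Const 0) (Const 0))
    (PFor 8 (PIf (Read 5 (var 8)) PSkip
      (PIf (within R r (var 8))
        (PIf (cover_count q (var 8)) PSkip (PWrite 12 (Const 0) (Const 1)))
        PSkip))).

(** Two loops per edge, hence [2q] nested loops: the exponent of the running time comes from
    here. *)
Fixpoint enum_tuples (q : nat) (body : prog) : prog :=
  if q is q'.+1 then
    PFor (src q') (PFor (dst q')
      (PIf (adj (var (src q')) (var (dst q'))) (enum_tuples q' body) PSkip))
  else body.

Definition search (R r q : nat) : prog :=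
  PSeq (PWrite 11 (Const 0) (Const 0))
    (enum_tuples q (PSeq (check R r q)
      (PIf (var 12) PSkip (PWrite 11 (Const 0) (Const 1))))).

Fixpoint emit (q : nat) : prog :=
  if q is q'.+1 then
    PSeq (PWrite 2 (Add (Read 3 (var (src q'))) (var (dst q'))) (Const 1))
      (emit q')
  else PSkip.

Definition kill (R r : nat) : prog :=
  PFor 8 (PIf (within R r (var 8)) (PWrite 5 (var 8) (Const 1)) PSkip).

(** Flag 10 stops further output once a tuple has been chosen for the present ball. *)
Definition commit (R r q : nat) : prog :=
  PIf (var 10) PSkip (PSeq (check R r q) (PIf (var 12) PSkip
    (PSeq (PSeq (emit q) (kill R r)) (PWrite 10 (Const 0) (Const 1))))).

(** The failure of [q.-1] edges on the inner ball certifies that its optimum is at least [q]; only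
    then are [q'] edges sought for the ball of radius [r + 3]. *)
Definition level (R r q q' : nat) : prog :=
  PSeq (search R r q.-1)
    (PIf (var 11) PSkip (enum_tuples q' (commit R r.+3 q'))).

Definition levels (k R : nat) (l : seq (nat * nat)) : prog :=
  foldr (fun jq => PSeq (level R (3 * jq.1) jq.2 (k.+1 * jq.2 %/ k))) PSkip l.

(** Neither the suitable radius nor the optimum is known in advance, so all pairs are tried. *)
Definition process (k R m K : nat) : prog :=
  PSeq (PWrite 10 (Const 0) (Const 0)) 
    (PSeq (bfs R) (levels k R [seq (j, q) | j <- iota 0 m, q <- iota 1 K])).

Definition ptas (k R m K : nat) : prog :=
  PSeq offsets (PFor 6 (PIf (Read 5 (var 6)) PSkip (process k R m K))).

Lemma writes_enum a q body : a \in writes (enum_tuples q body) ->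
  a \in writes body \/ 12 < a < 13 + q.*2.
Proof.
elim: q => [|q IHq] /=; first by left.
rewrite !inE cats0 => /or3P[/eqP->|/eqP->|/IHq[]]; first 3 last.
- by right; lia.
- by right; rewrite /src; lia.
- by right; rewrite /dst; lia.
- by left.
Qed.

Lemma writes_emit q a : a \in writes (emit q) -> a = 2.
Proof. by elim: q => //= q IHq; rewrite inE => /orP[/eqP|/IHq]. Qed.

Lemma run_emit q s a : a != 2 -> run (emit q) s a = s a.
Proof.
by move=> a2; rewrite run_frame //; apply: contra a2 => /writes_emit ->.
Qed.

Lemma writes_commit R r q a :
  a \in writes (commit R r q) -> a \in [:: 2; 5; 8; 10; 12].
Proof.
have [/writes_emit -> //|/negbTE ne] := boolP (a \in writes (emit q)).
by rewrite /= !(inE, mem_cat) ne; lia.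
Qed.

Lemma writes_level R r q q' a : a \in writes (level R r q q') ->
  a \in [:: 2; 5; 8; 10; 11; 12] \/ 12 < a.
Proof.
rewrite /level /search [writes _]/= inE mem_cat => /or3P[/eqP ->||]; first by left.
- case/writes_enum => [|/andP[]]; last by right.
  by rewrite /= !inE; left; lia.
- case/writes_enum => [/writes_commit|/andP[]]; last by right.
  by rewrite !inE; left; lia.
Qed.

Section Correctness.
Variables (n : nat) (e : rel 'I_n).
Hypotheses (e_simple : simple_graph e) (e_no_isolated : no_isolated e).
Implicit Types (s : store) (u v w : 'I_n) (t : nat -> 'I_n * 'I_n).

Definition env s : Prop :=
  [/\ s 0 0 = n, forall u w, s 1 (u * n + w) = e u w
    & forall u, s 3 u = u * n].

Lemma env_frame s s' : s' 0 = s 0 -> s' 1 = s 1 -> s' 3 = s 3 -> env s -> env s'.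
Proof. by rewrite /env => -> -> ->. Qed.

Lemma eval_adj s x y u w : env s -> eval s x = u -> eval s y = w ->
  eval s (adj x y) = e u w.
Proof. by move=> [_ sA sO] /= -> ->; rewrite sO sA. Qed.

(** * Breadth-first labels and the covering test *)

Section Labels.
Variables (R : nat) (v : 'I_n).

(** The state after [l] rounds: labels are right up to distance [l], and by the second clause no
    vertex further away has one yet. *)
Definition labels (l : nat) s : Prop :=
  (forall r, r <= l -> forall w, (R - r < s 7 w) = (w \in ball e v r)) /\
  (forall w, s 7 w != 0 -> R - l < s 7 w).

Lemma bfs_step_labels l s : l < R -> env s -> labels l s ->
  labels l.+1 (run (bfs_step R l) s).
Proof.
move=> lR es [lab lab0]; have [s00 _ _] := es.
(* [J] lists what the round may change; [C] says that the neighbours of those among the first [m]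
   vertices that lie in the ball have been labelled. *)
pose J s' := forall w, s' 7 w = s 7 w \/
  [/\ s 7 w = 0, s' 7 w = R - l & w \in ball e v l.+1].
pose C (m : nat) s' := forall u w, u < m -> u \in ball e v l -> e u w -> s' 7 w != 0.
rewrite /bfs_step; apply: (@for_ind _ _ _ (fun m s' => J s' /\ C m s')).
- by split=> [w|u w //]; left.
- move=> m s1; rewrite s00 => m_lt fr1 [J1 C1]; pose i := Ordinal m_lt.
  have s1n : update s1 8 0 m 0 0 = n by rewrite /update /= fr1.
  apply: (@for_ind _ _ _ (fun k s' => [/\ J s', C m s' &
     forall w, w < k -> i \in ball e v l -> e i w -> s' 7 w != 0])
     (fun s' => J s' /\ C m.+1 s')).
  + by split.
  + move=> k s2; rewrite s1n => k_lt fr2 [J2 C2 D2]; pose j := Ordinal k_lt.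
    set s3 := update s2 9 0 k.
    have e3 : env s3.
      by apply: env_frame es; rewrite /s3 update_other // fr2 // update_other // fr1.
    have s38 : s3 8 0 = i by rewrite /s3 update_other // fr2 // update_same.
    have s39 : s3 9 0 = j by rewrite /s3 update_same.
    have s37 : s3 7 = s2 7 by rewrite /s3 update_other.
    have inner w : w < k.+1 -> w = j \/ w < k.
      rewrite ltnS leq_eqVlt => /orP[/eqP wk|]; last by right.
      by left; apply: val_inj.
    (* A vertex labelled in this very round has label [R - l] and fails the strict test. *)
    have iball : (s2 7 i - (R - l) != 0) = (i \in ball e v l).
      rewrite subn_eq0 -ltnNge.
      have [->|[s0 -> _]] := J2 i; first exact: lab.
      by rewrite ltnn -lab // s0.
    have ev1 : eval s3 (within R l (var 8)) = s2 7 i - (R - l) by rewrite /= s37 s38.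
    have ev2 := @eval_adj s3 (var 8) (var 9) i j e3 s38 s39.
    have ev3 : eval s3 (Read 7 (var 9)) = s2 7 j by rewrite /= s37 s39.
    rewrite !run_if ev1 ev2 ev3 iball [run (PWrite _ _ _) _]/= s39.
    case: (boolP (i \in ball e v l)) => il; last first.
      by split; rewrite /J /C ?s37 // => w /inner[_|wk] // ib; rewrite ib in il.
    case: (boolP (e i j)) => eij /=; last first.
      split; rewrite /J /C ?s37 // => w /inner[->|wk] _ ew.
        by rewrite ew in eij.
      exact: D2.
    case: eqP => s2j /=.
      have upd w : update s3 7 k (R - l) 7 w = if w == j then R - l else s2 7 w.
        by rewrite /update /= s37.
      have Rl : R - l != 0 by rewrite subn_eq0 -ltnNge.
      split.
      * move=> w; rewrite upd; case: eqVneq => [->|_]; last exact: J2.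
        right; split=> //; last exact: ball_step il eij.
        by have [<-|[]] := J2 j.
      * by move=> u w um ul ew; rewrite upd; case: ifP => // _; exact: (C2 _ _ um ul ew).
      * move=> w /inner wk _ ew; rewrite upd; case: ifP => // /eqP wj.
        by case: wk => // wk; apply: D2.
    split; rewrite /J /C ?s37 // => w /inner[->|wk] _ ew; first exact/eqP.
    exact: D2.
  + move=> s2 fr2 [J2 C2 D2].
    split=> [w|u w]; rewrite /J /C ?update_other //.
    rewrite ltnS leq_eqVlt => /orP[/eqP um|um]; last exact: C2.
    have -> : u = i by apply: val_inj.
    by apply: D2; rewrite s1n.
- move=> s1 _ []; rewrite s00 => J1 C1.
  have s1E w : s1 7 w = s 7 w \/
     [/\ s 7 w = 0, s1 7 w = R - l, w \in ball e v l.+1 & w \notin ball e v l].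
    have [|[s0 s1w wl]] := J1 w; first by left.
    by right; split=> //; rewrite -lab // s0.
  split=> [r|w]; rewrite update_other //; last first.
    by have [->|[_ -> _ _]] := s1E w; [move=> /lab0|]; lia.
  rewrite leq_eqVlt => /orP[/eqP ->|rl] w; last first.
    have [->|[_ -> _ wl]] := s1E w; first exact: lab.
    rewrite (contraNF (fintype.subsetP (ball_mono e v _) w) wl) //.
    by apply/negbTE; rewrite -leqNgt leq_sub2l.
  have [sw|[_ -> -> _]] := s1E w; last by lia.
  rewrite in_ballS -lab // sw.
  apply/idP/orP => [sw0|[sw0|]]; [left|lia|].
    by apply: lab0; lia.
  move=> /existsP[u /andP[ul ew]].
  have := C1 u w (ltn_ord u) ul ew; rewrite sw => /lab0.
  by lia.
Qed.

Lemma env_run p s : env s -> 1 \notin writes p -> 3 \notin writes p -> wf p ->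
  env (run p s).
Proof.
move=> es p1 p3 pwf.
by apply: env_frame es; apply: run_frame; rewrite ?wf_writes0.
Qed.

Lemma writes_bfs_steps l a : a \in writes (bfs_steps R l) -> a \in [:: 7; 8; 9].
Proof.
elim: l => [|l IHl] //=; rewrite mem_cat => /orP[/IHl//|].
by rewrite !inE => /or3P[]/eqP->.
Qed.

Lemma bfs_labels s : env s -> s 6 0 = v -> labels R (run (bfs R) s).
Proof.
move=> es s6; have [s00 _ _] := es.
rewrite /bfs !run_seq; set s1 := run (PFor _ _) s.
have s10 w : s1 7 w = 0.
  apply: (@for_ind _ _ _ (fun m s' => forall w : 'I_n, w < m -> s' 7 w = 0)
    (fun s' => s' 7 w = 0)) => //=.
    move=> m s2 m_lt fr0 H u; rewrite ltnS update_same /update /=.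
    by case: eqP => [//|um]; rewrite leq_eqVlt => /orP[/eqP//|/H].
  by move=> s2 _; rewrite s00 => H; rewrite update_other // H.
have e1 : env s1 by apply: env_run.
have s16 : s1 6 0 = v by rewrite /s1 run_frame.
have -> : run (PWrite 7 (var 6) (Const R.+1)) s1 = update s1 7 v R.+1.
  by rewrite /= s16.
set s2 := update _ _ _ _.
have e2 : env s2 by apply: env_frame e1; rewrite /s2 update_other.
have l2 : labels 0 s2.
  have s2w w : s2 7 w = if w == v then R.+1 else 0 by rewrite /s2 /update /= s10.
  split=> [r|w]; last by rewrite s2w; case: ifP => // _; lia.
  rewrite leqn0 => /eqP -> w; rewrite s2w /ball inE.
  by case: ifP => _; lia.
have steps l : l <= R -> env (run (bfs_steps R l) s2) /\ labels l (run (bfs_steps R l) s2).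
  elim: l => [|l IHl] lR; first by [].
  have [el ll] := IHl (ltnW lR); rewrite [bfs_steps _ _]/= run_seq; split.
    exact: env_run.
  exact: bfs_step_labels.
by have [] := steps R (leqnn R).
Qed.

Lemma eval_within s r x u : labels R s -> r <= R -> eval s x = u ->
  (eval s (within R r x) != 0) = (u \in ball e v r).
Proof. by move=> [lab _] rR /= ->; rewrite subn_eq0 -ltnNge lab. Qed.

Definition target s r : {set 'I_n} := [set u in ball e v r | s 5 u == 0].

Definition loaded s t (i : nat) : Prop :=
  [/\ s (src i) 0 = (t i).1, s (dst i) 0 = (t i).2 & e (t i).1 (t i).2].

Lemma eval_cover_count s t q x u : env s -> eval s x = u ->
  (forall i, i < q -> loaded s t i) ->
  (eval s (cover_count q x) != 0) <-> exists2 i, i < q & pair_dominates e (t i) u.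
Proof.
move=> es xu; elim: q => [|q IHq] ld; first by split=> // -[].
have [tx ty _] := ld q (ltnSn q).
have -> : eval s (cover_count q.+1 x) =
    e (t q).1 u + e (t q).2 u + eval s (cover_count q x).
  by rewrite -(eval_adj es (x := var (src q)) tx xu) -(eval_adj es (x := var (dst q)) ty xu).
have {}IHq := IHq (fun i iq => ld i (ltnW iq)).
rewrite addn_eq0 negb_and; split=> [/orP[h|/IHq[i iq ti]]|[i]].
- exists q => //; rewrite /pair_dominates; move: h.
  by case: (e _ _); case: (e _ _).
- by exists i => //; apply: ltnW.
- rewrite ltnS leq_eqVlt => /orP[/eqP -> ti|iq ti]; apply/orP; [left|right].
    by move: ti; rewrite /pair_dominates; case: (e _ _); case: (e _ _).
  by apply/IHq; exists i.
Qed.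

Lemma src_neq i a : a < 13 -> a != src i.
Proof. by rewrite /src; lia. Qed.

Lemma dst_neq i a : a < 13 -> a != dst i.
Proof. by rewrite /dst; lia. Qed.

Lemma loaded_frame s s' t i : s' (src i) = s (src i) -> s' (dst i) = s (dst i) ->
  loaded s t i -> loaded s' t i.
Proof. by rewrite /loaded => -> ->. Qed.

Lemma check_covers s t r q : env s -> labels R s -> r <= R ->
  (forall i, i < q -> loaded s t i) ->
  run (check R r q) s 12 0 = 0 <-> covers e t q (target s r).
Proof.
move=> es ls rR ld; have [s00 _ _] := es.
rewrite /check run_seq; set s1 := run (PWrite _ _ _) s.
have s10 : s1 0 0 = n by rewrite /s1 run_frame.
apply: (@for_ind _ _ _ (fun m s' => s' 12 0 = 0 <->
    forall u, u < m -> u \in target s r ->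
      exists2 i, i < q & pair_dominates e (t i) u)
  (fun s' => s' 12 0 = 0 <-> covers e t q (target s r))).
- by split.
- move=> m s2; rewrite s10 => m_lt fr2 I2; pose u := Ordinal m_lt.
  set s3 := update s2 8 0 m.
  have fr3 a : a != 8 -> a != 12 -> s3 a = s a.
    move=> a8 a12; rewrite /s3 update_other // fr2 ?inE ?negb_or ?a8 ?a12 //.
    by rewrite /s1 /= update_other.
  have e3 : env s3 by apply: env_frame es; apply: fr3.
  have s38 : eval s3 (var 8) = u by rewrite /= /s3 update_same.
  have l3 : labels R s3 by rewrite /labels fr3.
  have ld3 i : i < q -> loaded s3 t i.
    by move=> /ld; apply: loaded_frame; apply: fr3; rewrite eq_sym ?src_neq ?dst_neq.
  have s312 : s3 12 = s2 12 by rewrite /s3 update_other.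
  have last_step : (s2 12 0 = 0 /\ (u \in target s r ->
        exists2 i, i < q & pair_dominates e (t i) u)) <->
      (forall w, w < m.+1 -> w \in target s r ->
        exists2 i, i < q & pair_dominates e (t i) w).
    split=> [[/I2 h hu] w|h].
      rewrite ltnS leq_eqVlt => /orP[/eqP wm|/h //].
      by have -> : w = u by apply: val_inj.
    split; last exact: h.
    by apply/I2 => w wm; apply: h; apply: ltnW.
  rewrite -last_step !run_if (eval_within l3 rR s38).
  have -> : eval s3 (Read 5 (var 8)) = s 5 u by rewrite -(fr3 5) //= -s38.
  rewrite [u \in target s r]inE.
  case: (eqVneq (s 5 u) 0) => su /=; last first.
    by rewrite andbF s312; split=> [|[]].
  rewrite andbT; case: (u \in ball e v r); last first.
    by rewrite s312; split=> [|[]].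
  have cc := eval_cover_count e3 s38 ld3.
  case: eqP => c0 /=.
    rewrite update_same; split=> // -[_ /(_ isT)/cc].
    by rewrite c0.
  rewrite s312; split=> [s20|[]//]; split=> // _.
  by apply/cc/eqP.
- move=> s2 fr2; rewrite s10 update_other // => ->.
  by split=> [h u|h u _] ; apply: h.
Qed.

End Labels.

(** * Enumeration of all tuples of edges *)

Section Enumeration.
Variables (Q : nat) (body : prog).
Hypothesis body_writes : forall a, a \in writes body -> a < 13.

(** Closure conditions: [I] tolerates changes of the tuple variables, keeps the adjacency tests
    meaningful, and survives the body whenever the current tuple consists of edges. *)
Definition tuple_invariant (I : store -> Prop) : Prop :=
  [/\ forall s a x, 12 < a -> I s -> I (update s a 0 x),
      forall s, I s -> env s
    & forall s t, I s -> (forall i, i < Q -> loaded s t i) -> I (run body s)].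

Let loop (q : nat) : prog :=
  PIf (adj (var (src q)) (var (dst q))) (enum_tuples q body) PSkip.

(** The outer loops fix the highest indices first, so with [q] levels remaining the entries from [q]
    on are set. *)
Let loaded_above s t (q : nat) : Prop := forall i, q <= i < Q -> loaded s t i.

Let writes_enum_lt q a : a \in writes (enum_tuples q body) -> a < 13 + q.*2.
Proof. by case/writes_enum => [/body_writes|]; lia. Qed.

Let loaded_update s t q b x : b < src q.+1 ->
  loaded_above s t q.+1 -> loaded_above (update s b 0 x) t q.+1.
Proof.
by move=> bq ld i iq; apply: loaded_frame (ld i iq); rewrite update_other //;
  move: bq iq; rewrite /src /dst; lia.
Qed.

Let loaded_loop s t q : loaded_above s t q.+1 -> loaded_above (run (loop q) s) t q.+1.
Proof.
move=> ld i iq; apply: loaded_frame (ld i iq); rewrite run_frame //=;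
  rewrite cats0; apply/negP => /writes_enum_lt; move: iq; rewrite /src /dst; lia.
Qed.

Let src_loop s q : run (loop q) s (src q) = s (src q).
Proof.
by rewrite run_frame //= cats0; apply/negP => /writes_enum_lt; rewrite /src; lia.
Qed.

Let loaded_last s t q u w : s (src q) 0 = u -> s (dst q) 0 = w -> e u w ->
  loaded_above s t q.+1 -> loaded_above s (fun i => if i == q then (u, w) else t i) q.
Proof.
move=> su sw euw ld i; case/andP; rewrite leq_eqVlt => /orP[/eqP <- _|qi iQ].
  by rewrite /loaded eqxx.
by rewrite /loaded gtn_eqF //; apply: ld; rewrite qi.
Qed.

Let inv_at (I : store -> Prop) t (q : nat) s : Prop :=
  I s /\ loaded_above s t q.+1.

Let loop_inv I t q s u w : tuple_invariant I ->
  (forall s t, I s -> loaded_above s t q -> I (run (enum_tuples q body) s)) ->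
  inv_at I t q s -> s (src q) 0 = u -> s (dst q) 0 = w ->
  inv_at I t q (run (loop q) s).
Proof.
move=> [_ Ienv _] IHq [Is ld] su sw; split; last exact: loaded_loop.
rewrite /loop run_if (@eval_adj _ _ (var (dst q)) u w (Ienv _ Is)) //.
by case: (boolP (e u w)) => //= euw; apply: IHq (loaded_last su sw euw ld).
Qed.

Let inv_update I t q s b x : tuple_invariant I -> 12 < b < src q.+1 ->
  inv_at I t q s -> inv_at I t q (update s b 0 x).
Proof.
by move=> [Iup _ _] /andP[b12 bq] [Is ld]; split; [apply: Iup|apply: loaded_update].
Qed.

Let src_range q : 12 < src q < src q.+1.
Proof. by rewrite /src; lia. Qed.

Let dst_range q : 12 < dst q < src q.+1.
Proof. by rewrite /src /dst; lia. Qed.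

Let src_dst q : src q != dst q.
Proof. by rewrite /src /dst; lia. Qed.

Let inner_inv I t q s u : tuple_invariant I ->
  (forall s t, I s -> loaded_above s t q -> I (run (enum_tuples q body) s)) ->
  inv_at I t q s -> s (src q) 0 = u ->
  inv_at I t q (run (PFor (dst q) (loop q)) s).
Proof.
move=> TI IHq Is su; have [_ Ienv _] := TI; have [s00 _ _] := Ienv _ Is.1.
suff [] : inv_at I t q (run (PFor (dst q) (loop q)) s) /\
  run (PFor (dst q) (loop q)) s (src q) 0 = u by [].
apply: (@for_preserve _ _ _ (fun s' => inv_at I t q s' /\ s' (src q) 0 = u)) => //.
  move=> j s1; rewrite s00 => jn [I1 s1u].
  have I2 := inv_update j TI (dst_range q) I1.
  split; last by rewrite src_loop update_other.
  apply: (loop_inv (u := u) (w := Ordinal jn) TI IHq I2).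
    by rewrite update_other.
  by rewrite update_same.
move=> s1 [I1 s1u]; split; first exact: inv_update (dst_range q) I1.
by rewrite update_other.
Qed.

Lemma enum_tuples_inv I : tuple_invariant I -> forall q s t, q <= Q -> I s ->
  loaded_above s t q -> I (run (enum_tuples q body) s).
Proof.
move=> TI; have [Iup Ienv Ibody] := TI.
elim=> [|q IHq] s t qQ Is ld; first exact: Ibody Is ld.
have [s00 _ _] := Ienv _ Is.
suff [] : inv_at I t q (run (enum_tuples q.+1 body) s) by [].
apply: (@for_preserve _ _ _ (inv_at I t q)) => //.
  move=> i s1; rewrite s00 => iq I1.
  apply: (inner_inv (u := Ordinal iq) TI).
  - by move=> s2 t2; apply: IHq; apply: ltnW.
  - exact: inv_update (src_range q) I1.
  - by rewrite update_same.
by move=> s1 I1; apply: inv_update (src_range q) I1.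
Qed.

(** The enumeration meets [t] by taking round [(t q).1] and then round [(t q).2] of each pair of
    loops; afterwards [G] lasts because [I] and [G] together are again an invariant. *)
Lemma enum_tuples_reach I (G : store -> Prop) t :
  tuple_invariant I -> tuple_invariant (fun s => I s /\ G s) ->
  (forall i, i < Q -> e (t i).1 (t i).2) ->
  (forall s, I s -> (forall i, i < Q -> loaded s t i) -> G (run body s)) ->
  forall q s, q <= Q -> I s -> loaded_above s t q ->
  G (run (enum_tuples q body) s).
Proof.
move=> TI TIG te Gbody; have [_ Ienv _] := TI.
elim=> [|q IHq] s qQ Is ld; first exact: Gbody Is ld.
have [s00 _ _] := Ienv _ Is.
have IH1 := fun s t => enum_tuples_inv TI (s := s) (t := t) (ltnW qQ).
have IH2 := fun s t => enum_tuples_inv TIG (s := s) (t := t) (ltnW qQ).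
have split_inv s1 : inv_at I t q s1 -> G s1 -> inv_at (fun s => I s /\ G s) t q s1.
  by move=> [].
have GU s1 b x : 12 < b < src q.+1 -> inv_at I t q s1 -> G s1 -> G (update s1 b 0 x).
  by move=> bq I1 G1; have [[]] := inv_update x TIG bq (split_inv _ I1 G1).
apply: (@for_reach _ _ _ (inv_at I t q) _ (t q).1) => //; first by rewrite s00.
- move=> i s1; rewrite s00 => iq I1.
  apply: (inner_inv (u := Ordinal iq) TI IH1).
    exact: inv_update (src_range q) I1.
  by rewrite update_same.
- move=> s1 I1; set s2 := update _ _ _ _.
  have I2 : inv_at I t q s2 by apply: inv_update (src_range q) I1.
  have s2u : s2 (src q) 0 = (t q).1 by rewrite /s2 update_same.
  have [s20 _ _] := Ienv _ I2.1.
  have sl j s3 : j < s2 0 0 -> inv_at I t q s3 /\ s3 (src q) 0 = (t q).1 ->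
    inv_at I t q (run (loop q) (update s3 (dst q) 0 j)) /\
    run (loop q) (update s3 (dst q) 0 j) (src q) 0 = (t q).1.
    rewrite s20 => jn [I3 s3u].
    split; last by rewrite src_loop update_other.
    apply: (loop_inv (u := (t q).1) (w := Ordinal jn) TI IH1).
    + exact: inv_update (dst_range q) I3.
    + by rewrite update_other.
    + by rewrite update_same.
  apply: (@for_reach _ _ _ (fun s' => inv_at I t q s' /\ s' (src q) 0 = (t q).1)
    _ (t q).2) => //; first by rewrite s20.
  + move=> s3 [I3 s3u]; set s4 := update _ _ _ _.
    have [I4 ld4] : inv_at I t q s4 by apply: inv_update (dst_range q) I3.
    have s4u : s4 (src q) 0 = (t q).1 by rewrite /s4 update_other.
    have s4w : s4 (dst q) 0 = (t q).2 by rewrite /s4 update_same.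
    rewrite run_if (@eval_adj _ (var (src q)) (var (dst q)) _ _ (Ienv _ I4) s4u s4w) te //=.
    apply: IHq (ltnW qQ) I4 _ => i; case/andP.
    rewrite leq_eqVlt => /orP[/eqP <- _|qi iQ]; last by apply: ld4; rewrite qi.
    by split=> //; apply: te.
  + move=> j s3; rewrite s20 => jn [I3 s3u] G3.
    have [] // : inv_at (fun s => I s /\ G s) t q (run (loop q) (update s3 (dst q) 0 j)).
      apply: (loop_inv (u := (t q).1) (w := Ordinal jn) TIG IH2).
      * exact: inv_update (dst_range q) (split_inv _ I3 G3).
      * by rewrite update_other.
      * by rewrite update_same.
    by case.
  + by move=> s3 [I3 _]; apply: GU.
- move=> i s1; rewrite s00 => iq I1 G1.
  have [[]] // := inner_inv (u := Ordinal iq) TIG IH2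
    (inv_update i TIG (src_range q) (split_inv _ I1 G1)) (update_same _ _ _ _).
- by move=> s1; apply: GU.
Qed.

End Enumeration.

(** * One ball: search, commitment and the approximation invariant *)

Section Ball.
Variables (k R : nat) (v : 'I_n).

(** Soundness is an invariant of the enumeration; completeness holds since a tuple witnessing [dom]
    is reached and the flag is not reset afterwards. *)
Lemma search_dom s r q : env s -> labels R v R s -> r <= R ->
  run (search R r q) s 11 0 != 0 <-> dom e q (target v s r).
Proof.
move=> es ls rR; rewrite /search run_seq; set s1 := run (PWrite _ _ _) s.
set body := PSeq _ _.
have body_lt a : a \in writes body -> a < 13 by rewrite !inE; lia.
pose I s' := (forall a, a < 13 -> a \notin [:: 8; 11; 12] -> s' a = s a) /\
  (s' 11 0 != 0 -> dom e q (target v s r)).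
have Ienv s' : I s' -> env s' by move=> [fr _]; apply: env_frame es; apply: fr.
have body_run s' t : I s' -> (forall i, i < q -> loaded s' t i) ->
    run body s' 11 0 = 0 -> s' 11 0 = 0 /\ ~ covers e t q (target v s r).
  move=> Is ld; have [fr _] := Is.
  have ls' : labels R v R s' by rewrite /labels fr.
  have := check_covers (Ienv _ Is) ls' rR ld.
  rewrite /target fr // -/(target v s r) /body run_seq run_if.
  set s2 := run (check _ _ _) _ => H.
  case: (eqVneq (eval s2 (var 12)) 0) => [_|s212] /=; first by rewrite update_same.
  by rewrite {1}/s2 run_frame // => s20; split=> // /H h; rewrite /= h in s212.
have body_cov s' t : I s' -> (forall i, i < q -> loaded s' t i) ->
    run body s' 11 0 != 0 -> s' 11 0 != 0 \/ covers e t q (target v s r).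
  move=> Is ld; have [fr _] := Is.
  have ls' : labels R v R s' by rewrite /labels fr.
  have := check_covers (Ienv _ Is) ls' rR ld.
  rewrite /target fr // -/(target v s r) /body run_seq run_if.
  set s2 := run (check _ _ _) _ => H.
  case: (eqVneq (eval s2 (var 12)) 0) => [s212 _|s212] /=; first by right; apply/H.
  by rewrite {1}/s2 run_frame // => s20; left.
have TI : tuple_invariant q body I.
  split=> // [s' a x a12 [fr Id]|s' t Is ld].
    split=> [b b13 bn|]; first by rewrite update_other ?fr //; lia.
    by rewrite update_other //; lia.
  have [fr Id] := Is; split=> [a a13 an|/(body_cov _ _ Is ld)[/Id//|cov]].
    rewrite run_frame ?fr //; move: an; rewrite !inE !negb_or; lia.
  by exists t => // i /ld[].
have Is1 : I s1.
  split; last by [].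
  move=> a a13; rewrite !inE !negb_or => /and3P[_ a11 _].
  by rewrite /s1 /= update_other.
have vac t : forall i, q <= i < q -> loaded s1 t i by lia.
split.
  by have [_] := enum_tuples_inv body_lt TI (leqnn q) Is1 (vac (fun=> (v, v))).
move=> [t te tcov].
apply: (enum_tuples_reach (G := fun s' => s' 11 0 != 0) body_lt TI _ te _
  (leqnn q) Is1 (vac t)).
  split=> [s' a x a12 [Is G]|s' [/Ienv]|s' t' [Is G] ld] //.
    split; first by have [Iup _ _] := TI; apply: Iup.
    by rewrite update_other //; lia.
  split; first by have [_ _ Ib] := TI; apply: Ib ld.
  by apply/eqP => /(body_run _ _ Is ld)[/eqP]; rewrite (negbTE G).
by move=> s' Is ld; apply/eqP => /(body_run _ _ Is ld)[_].
Qed.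

Definition marked s (u w : 'I_n) : bool := s 2 (u * n + w) != 0.

Lemma index_inj (u w u' w' : 'I_n) : u * n + w = u' * n + w' -> (u, w) = (u', w').
Proof.
move=> E; have n0 : 0 < n by apply: leq_trans (ltn_ord u).
have Eu : u = u' :> nat.
  by have := congr1 (divn^~ n) E; rewrite !divnMDl // !divn_small // !addn0.
by move: E; rewrite Eu => /addnI Ew; congr (_, _); apply: val_inj.
Qed.

Lemma marked_update s (a b u w : 'I_n) :
  marked (update s 2 (a * n + b) 1) u w = ((u, w) == (a, b)) || marked s u w.
Proof.
rewrite /marked /update eqxx /=; case: ifP => [/eqP/index_inj ->|h]; first by rewrite eqxx.
by case: (eqVneq (u, w) (a, b)) => // -[uE wE]; rewrite uE wE eqxx in h.
Qed.

(** Repeated edges and edges already present add nothing, hence only an upper bound on the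
    cardinality. *)
Lemma emitP q s t : env s -> (forall i, i < q -> loaded s t i) ->
  (forall u w, marked (run (emit q) s) u w <->
     marked s u w \/ exists2 i, i < q & t i = (u, w)) /\
  #|output_edges n (run (emit q) s)| <= #|output_edges n s| + q.
Proof.
elim: q s => [|q IHq] s es ld.
  by rewrite addn0; split=> // u w; split=> [|[//|[]//]]; left.
have [_ _ sO] := es; have [tu tw _] := ld q (ltnSn q).
rewrite [emit _]/= run_seq; set s1 := run (PWrite _ _ _) s.
have s1E : s1 = update s 2 ((t q).1 * n + (t q).2) 1 by rewrite /s1 /= tu tw sO.
have e1 : env s1 by apply: env_run.
have ld1 i : i < q -> loaded s1 t i.
  by move=> iq; apply: loaded_frame (ld i (ltnW iq)); rewrite s1E update_other.
have [markE card] := IHq s1 e1 ld1; split=> [u w|].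
  rewrite markE s1E marked_update; split.
    case=> [/orP[/eqP ->|]|[i iq ti]].
    - by right; exists q => //; case: (t q).
    - by left.
    - by right; exists i => //; apply: ltnW.
  case=> [mk|[i]]; first by left; rewrite mk orbT.
  rewrite ltnS leq_eqVlt => /orP[/eqP -> <-|iq ti]; last by right; exists i.
  by left; case: (t q) => ? ?; rewrite eqxx.
apply: leq_trans card _; rewrite -addSnnS leq_add2r.
apply: (@leq_trans #|[set (t q).1; (t q).2] |: output_edges n s|); last first.
  by rewrite cardsU1 -add1n leq_add2r leq_b1.
apply: subset_leq_card; apply/fintype.subsetP => f /imset2P[u w _].
rewrite inE /= -/(marked s1 u w) s1E marked_update => mk ->.
rewrite in_setU1; case/orP: mk => [/eqP[-> ->]|mk]; first by rewrite eqxx.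
by apply/orP; right; apply/imset2P; exists u w; rewrite ?inE.
Qed.

Lemma killP s r u : s 0 0 = n -> labels R v R s -> r <= R ->
  (run (kill R r) s 5 u != 0) = (s 5 u != 0) || (u \in ball e v r).
Proof.
move=> s00 ls rR; rewrite /kill.
apply: (@for_ind _ _ _ (fun m s' => forall w, (s' 5 w != 0) =
    (s 5 w != 0) || (w < m) && (w \in ball e v r))
  (fun s' => (s' 5 u != 0) = (s 5 u != 0) || (u \in ball e v r))).
- by move=> w; rewrite orbF.
- move=> m s1; rewrite s00 => m_lt fr I1 w; pose u' := Ordinal m_lt.
  set s2 := update s1 8 0 m.
  have l2 : labels R v R s2 by rewrite /labels /s2 update_other // fr.
  have s28 : eval s2 (var 8) = u' by rewrite /= /s2 update_same.
  have s25 : s2 5 = s1 5 by rewrite /s2 update_other.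
  have lastE : (w < m.+1) = (w == u') || (w < m) by rewrite ltnS leq_eqVlt.
  rewrite run_if (eval_within l2 rR s28) lastE.
  case: ifP => [ub|ub] /=; last first.
    rewrite s25 I1; case: (eqVneq w u') => [->|//].
    by rewrite ub !andbF.
  rewrite -/(s2 8 0) [s2 8 0]s28 /update eqxx /= s25.
  rewrite -[_ == m]/(w == u'); case: (eqVneq w u') => [->|_]; last exact: I1.
  by rewrite ub orbT.
- by move=> s1 fr I1; rewrite update_other // I1 s00 ltn_ord.
Qed.

(** The invariant behind the ratio: discarded vertices, those marked in array 5, are dominated by
    the output, and the output is charged to the bound [N] of a packing whose third set is the
    discarded part. *)
Definition solution s : Prop :=
  (forall u w, marked s u w -> e u w) /\
  exists U N, [/\ forall u, s 5 u != 0 ->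
                    exists2 p, marked s p.1 p.2 & pair_dominates e p u,
                  k * #|output_edges n s| <= k.+1 * N
                & packing e U N [set u : 'I_n | s 5 u != 0]].

(** One round adds at most [q'] edges to the output and [q] to the packing bound, as [q.-1] edges
    fail on the inner ball. The discarded ball has radius [r + 3], just as in [packing_step]. *)
Lemma commit_solution s t r q q' : env s -> labels R v R s -> solution s ->
  r.+3 <= R -> 0 < q -> k * q' <= k.+1 * q ->
  (forall i, i < q' -> loaded s t i) -> covers e t q' (target v s r.+3) ->
  ~ dom e q.-1 (target v s r) ->
  solution (run (PSeq (emit q') (kill R r.+3)) s).
Proof.
move=> es ls [me [U [N [dU kO pU]]]] rR q0 kq ld cov nd; rewrite run_seq.
have [markE card] := emitP es ld; set s1 := run (emit q') s in markE card *.
have fr1 a : a != 2 -> s1 a = s a.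
  by move=> a2; rewrite /s1 run_emit.
have s10 : s1 0 0 = n by have [s00 _ _] := es; rewrite fr1.
have l1 : labels R v R s1 by rewrite /labels fr1.
have killE u := killP u s10 l1 rR; set s2 := run (kill _ _) s1 in killE *.
have m2 u w : marked s2 u w = marked s1 u w by rewrite /marked /s2 run_frame.
have O2 : output_edges n s2 = output_edges n s1.
  by rewrite /output_edges /s2 run_frame.
split=> [u w|]; first by rewrite m2 => /markE[/me//|[i /ld[_ _ +] tE]]; rewrite tE.
exists (U :|: target v s r), (N + q); split.
- move=> u; rewrite killE fr1 // => u2.
  have [/dU[p mp pu]|/negPn su] := boolP (s 5 u != 0).
    by exists p => //; rewrite m2; apply/markE; left.
  have [|i iq tu] := cov u.
    by rewrite inE su andbT; move: u2; rewrite su.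
  exists (t i) => //; rewrite m2; apply/markE; right; exists i => //.
  by case: (t i).
- rewrite O2 (leq_trans (leq_mul (leqnn k) card)) // mulnDr mulnDr.
  exact: leq_add.
- rewrite (_ : [set u : 'I_n | s2 5 u != 0] = [set u : 'I_n | s 5 u != 0] :|: ball e v r.+3).
    apply: packing_step => //; apply/fintype.subsetP => u.
    by rewrite !inE => /andP[-> /eqP ->].
  by apply/finset.setP => u; rewrite finset.in_setU [LHS]inE [X in X || _]inE killE fr1.
Qed.

(** [s0] is the store before the ball is treated. While flag 10 is zero nothing has been discarded
    since, so all tests refer to the same targets; once it is set, the centre is discarded. *)
Definition ball_invariant s0 s : Prop :=
  [/\ env s, s 6 0 = v, labels R v R s & solution s] /\
  [/\ forall u, s0 5 u != 0 -> s 5 u != 0, s 10 0 = 0 -> s 5 = s0 5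
    & s 10 0 != 0 -> s 5 v != 0].

Lemma ball_invariant_frame s0 s s' :
  (forall a, a \in [:: 0; 1; 2; 3; 5; 6; 7; 10] -> s' a = s a) ->
  ball_invariant s0 s -> ball_invariant s0 s'.
Proof.
by move=> fr; rewrite /ball_invariant /env /labels /solution /marked /output_edges !fr.
Qed.

Section Commit.
Variables (s0 : store) (r q q' : nat).
Hypotheses (rR : r.+3 <= R) (q_gt0 : 0 < q) (q_ratio : k * q' <= k.+1 * q).

Definition commit_invariant s : Prop :=
  ball_invariant s0 s /\ (s 10 0 = 0 -> ~ dom e q.-1 (target v s0 r)).

Let commit_lt a : a \in writes (commit R r.+3 q') -> a < 13.
Proof. by move/writes_commit; rewrite !inE; lia. Qed.

Lemma commit_step s t : commit_invariant s -> (forall i, i < q' -> loaded s t i) ->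
  commit_invariant (run (commit R r.+3 q') s) /\
  (s 10 0 != 0 \/ covers e t q' (target v s0 r.+3) ->
    run (commit R r.+3 q') s 10 0 != 0).
Proof.
move=> [Bs nd] ld; rewrite run_if.
have [/eqP s10|/negPn/eqP s10] := boolP (eval s (var 10) != 0).
  by split=> // _; apply/eqP.
have {}s10 : s 10 0 = 0 := s10.
have [[es s6 ls sols] [mono keep _]] := Bs.
rewrite run_seq; set s1 := run (check _ _ _) s.
have fr1 a : a != 8 -> a != 12 -> s1 a = s a.
  by move=> a8 a12; rewrite /s1 run_frame //= !inE !negb_or a8 a12.
have B1 : ball_invariant s0 s1.
  by apply: ball_invariant_frame Bs => a; rewrite !inE => ha; apply: fr1; lia.
have chk := check_covers es ls rR ld; rewrite -/s1 in chk.
have tgt r' : target v s r' = target v s0 r' by rewrite /target keep.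
rewrite tgt in chk; rewrite run_if.
have [s112|/negPn/eqP s112] := boolP (eval s1 (var 12) != 0).
  split; first by split; [exact: B1|move=> _; exact: nd].
  by case=> [//|/chk h]; rewrite /= h in s112.
have [[e1 s16 l1 sol1] [mono1 keep1 _]] := B1.
have ld1 i : i < q' -> loaded s1 t i.
  by move=> /ld; apply: loaded_frame; apply: fr1; rewrite eq_sym ?src_neq ?dst_neq.
have s15 : s1 5 = s 5 by apply: fr1.
have := commit_solution e1 l1 sol1 rR q_gt0 q_ratio ld1.
rewrite /target s15 -!/(target v s _) !tgt => /(_ _ (nd s10)) sol2.
have {}sol2 := sol2 (chk.1 s112).
rewrite run_seq; set s2 := run (PSeq _ _) s1 in sol2 *.
set s3 := run (PWrite _ _ _) s2.
have fr2 a : a \in [:: 0; 1; 3; 6; 7] -> s3 a = s1 a.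
  rewrite !inE => ha; rewrite /s3 run_frame; last by rewrite inE; lia.
  rewrite /s2 run_seq run_frame; last by rewrite !inE; lia.
  by rewrite run_emit //; lia.
have s310 : s3 10 0 = 1 by [].
have s35 u : (s3 5 u != 0) = (s1 5 u != 0) || (u \in ball e v r.+3).
  rewrite /s3 run_frame // /s2 run_seq.
  rewrite killP // ?run_emit //; last by rewrite /labels run_emit.
  by have [] := e1.
split; last by rewrite s310.
split; last by rewrite s310.
split; last first.
  rewrite s310; split=> // [u s0u|_]; rewrite s35 ?ball_center ?orbT //.
  by rewrite mono1.
split; rewrite ?fr2 //; first by apply: env_frame e1; apply: fr2.
by rewrite /labels fr2.
Qed.

Lemma commit_tuple_invariant :
  tuple_invariant q' (commit R r.+3 q') commit_invariant.
Proof.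
split=> [s a x a12 [Bs nd]|s [[[]]]//|s t Is ld]; last by have [] := commit_step Is ld.
split; last by rewrite update_other //; lia.
apply: ball_invariant_frame Bs => b; rewrite !inE => hb.
by rewrite update_other //; lia.
Qed.

Lemma commit_tuple_invariant_done : tuple_invariant q' (commit R r.+3 q')
  (fun s => commit_invariant s /\ s 10 0 != 0).
Proof.
have [Cup Cenv Cstep] := commit_tuple_invariant.
split=> [s a x a12 [Is d]|s [/Cenv]//|s t [Is d] ld].
  by split; [apply: Cup|rewrite update_other //; lia].
by have [? done] := commit_step Is ld; split=> //; apply: done; left.
Qed.

Lemma level_invariant s : ball_invariant s0 s ->
  [/\ ball_invariant s0 (run (level R r q q') s),
      s 10 0 != 0 -> run (level R r q q') s 10 0 != 0
    & ~ dom e q.-1 (target v s0 r) -> dom e q' (target v s0 r.+3) ->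
      run (level R r q q') s 10 0 != 0].
Proof.
move=> Bs; have [[es s6 ls sols] [mono keep _]] := Bs.
have rR' : r <= R by lia.
have search_dom := search_dom q.-1 es ls rR'.
rewrite /level run_seq run_if; set s1 := run (search _ _ _) s in search_dom *.
have fr1 a : a != 8 -> a < 11 -> s1 a = s a.
  move=> a8 a11; rewrite /s1 run_frame //= inE negb_or; apply/andP; split; first by lia.
  by apply/negP => /writes_enum[]; rewrite /= ?inE; lia.
have B1 : ball_invariant s0 s1.
  by apply: ball_invariant_frame Bs => a; rewrite !inE => ha; apply: fr1; lia.
have s110 : s1 10 = s 10 by apply: fr1.
case: ifP => [s111|/negbT/negPn/eqP s111].
  split; rewrite /= ?s110 // => nd d.
  apply/eqP => /keep keep0; apply: nd.
  by move/search_dom: s111; rewrite /target keep0.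
have C1 : commit_invariant s1.
  split=> //; rewrite s110 => /keep keep0 d.
  suff : s1 11 0 != 0 by rewrite [s1 11 0]s111.
  by apply/search_dom; rewrite /target keep0.
have vac t : forall i, q' <= i < q' -> loaded s1 t i by lia.
have TI := commit_tuple_invariant; have TID := commit_tuple_invariant_done.
split.
- by have [] := enum_tuples_inv commit_lt TI (leqnn q') C1 (vac (fun=> (v, v))).
- rewrite -s110 => d.
  by have [] := enum_tuples_inv commit_lt TID (leqnn q') (conj C1 d) (vac (fun=> (v, v))).
- move=> nd [t te cov].
  apply: (enum_tuples_reach (G := fun s' => s' 10 0 != 0) commit_lt TI TID te _
    (leqnn q') C1 (vac t)).
  by move=> s2 C2 ld; have [_] := commit_step C2 ld; apply; right.
Qed.

End Commit.

Lemma levels_invariant s0 s l :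
  (forall jq, jq \in l -> (3 * jq.1).+3 <= R /\ 0 < jq.2) -> 0 < k ->
  ball_invariant s0 s ->
  ball_invariant s0 (run (levels k R l) s) /\
  (s 10 0 != 0 \/ (exists2 jq, jq \in l &
      ~ dom e jq.2.-1 (target v s0 (3 * jq.1)) /\
      dom e (k.+1 * jq.2 %/ k) (target v s0 (3 * jq.1).+3)) ->
    run (levels k R l) s 10 0 != 0).
Proof.
move=> + k0; elim: l s => [|jq l IHl] s lP Bs.
  by split=> // -[//|[]].
have [jR q0] := lP jq (mem_head _ _).
have ratio : k * (k.+1 * jq.2 %/ k) <= k.+1 * jq.2 by rewrite mulnC leq_divM.
have [B1 stay new] := level_invariant jR q0 ratio Bs.
have [|B2 done] := IHl (run (level R (3 * jq.1) jq.2 (k.+1 * jq.2 %/ k)) s) _ B1.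
  by move=> jq' h; apply: lP; rewrite inE h orbT.
split=> // -[/stay d|[jq' + [nd d]]]; first by apply: done; left.
rewrite inE => /orP[/eqP E|jl]; apply: done; [left|right; exists jq' => //].
by apply: new; rewrite -E.
Qed.

(** [dom_growth] supplies a suitable pair among those listed, so some level commits and at least the
    centre is discarded. *)
Lemma process_invariant s m K :
  (forall r, r <= R -> dom e K (ball e v r)) -> 0 < k -> K * k ^ m < k.+1 ^ m ->
  R = 3 * m -> env s -> s 6 0 = v -> solution s -> s 5 v = 0 ->
  let s' := run (process k R m K) s in
  [/\ env s', solution s', forall u, s 5 u != 0 -> s' 5 u != 0 & s' 5 v != 0].
Proof.
move=> domK k0 growth Rm es s6 sols sv s'.
rewrite {}/s' /process 2!run_seq; set s1 := run (PWrite _ _ _) s.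
set s2 := run (bfs R) s1.
have bfs_fr a : a \notin [:: 7; 8; 9] -> s2 a = s1 a.
  rewrite !inE !negb_or => /and3P[a7 a8 a9]; rewrite /s2 run_frame //.
  rewrite /= !inE !negb_or a7 a8 /=.
  by apply/negP => /writes_bfs_steps; rewrite !inE (negbTE a7) (negbTE a8) (negbTE a9).
have fr a : a \notin [:: 7; 8; 9; 10] -> s2 a = s a.
  rewrite !inE => ha; rewrite bfs_fr ?inE; last by lia.
  by rewrite /s1 run_frame //= inE; lia.
have e1 : env s1 by apply: env_frame es; rewrite /s1 run_frame.
have l2 : labels R v R s2 by apply: bfs_labels.
have s210 : s2 10 0 = 0 by rewrite bfs_fr.
have B2 : ball_invariant s s2.
  split; split; rewrite ?s210 ?fr //; first by apply: env_frame es; apply: fr.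
  by move: sols; rewrite /solution /marked /output_edges !fr.
have lP jq : jq \in [seq (j, q) | j <- iota 0 m, q <- iota 1 K] ->
    (3 * jq.1).+3 <= R /\ 0 < jq.2.
  by move=> /allpairsP[[j q] [/= + + ->]]; rewrite !mem_iota /=; lia.
have [[[e3 _ _ sol3] [mono _ dv]] done] := levels_invariant lP k0 B2.
split=> //; apply: dv; apply: done; right.
have vA : v \in target v s (3 * 0) by rewrite inE ball_center sv.
have domA j : j <= m -> dom e K (target v s (3 * j)).
  move=> jm; have [|t te cov] := domK (3 * j); first by lia.
  by exists t => // a; rewrite inE => /andP[/cov].
have [j [q [jm /andP[q0 qK] nd d]]] :=
  dom_growth (A := fun j => target v s (3 * j)) e_no_isolated vA domA k0 growth.
exists (j, q) => /=; last by split=> //; move: d; rewrite mulnS.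
by apply/allpairsP; exists (j, q); rewrite /= !mem_iota; split=> //; lia.
Qed.

End Ball.

(** * Correctness of the whole program *)

Lemma input_store_adj u w : input_store e 1 (u * n + w) = e u w.
Proof.
rewrite /input_store /=; congr nat_of_bool; apply/existsP/idP.
  by move=> [a /existsP[b /andP[/eqP/index_inj[-> ->]]]].
by move=> euw; exists u; apply/existsP; exists w; rewrite eqxx.
Qed.

Lemma offsets_env : env (run offsets (input_store e)).
Proof.
set s := input_store e; have s00 : s 0 0 = n by [].
have offs : forall u, run offsets s 3 u = u * n.
  apply: (@for_ind _ _ _ (fun m s' => s' 4 0 = m * n /\
      forall u, u < m -> s' 3 u = u * n) (fun s' => forall u, s' 3 u = u * n)) => //.
    move=> m s1; rewrite s00 => m_lt fr [s14 s13].
    set s2 := update s1 6 0 m.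
    have s26 : s2 6 0 = m by [].
    have s24 : s2 4 0 = m * n by [].
    have s20 : s2 0 0 = n by rewrite /s2 update_other // fr.
    rewrite run_seq /= s26 s24; split.
      by rewrite update_same !update_other // s24 s20 mulSn addnC.
    move=> u um; rewrite update_other //.
    rewrite /update eqxx /=; case: eqP => [->//|um'].
    by rewrite /s2 update_other // s13 //; lia.
  by move=> s1 _ []; rewrite s00 => _ s13 u; rewrite update_other // s13.
split=> [|u w|//]; first by rewrite run_frame.
by rewrite run_frame // /s input_store_adj.
Qed.

(** Each round of the main loop leaves its vertex discarded, so in the end all vertices are
    dominated; by the packing, every solution has at least [N] edges. *)
Lemma ptas_correct (k m K : nat) : 0 < k -> K * k ^ m < k.+1 ^ m ->
  (forall v r, r <= 3 * m -> dom e K (ball e v r)) ->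
  let s := run (ptas k (3 * m) m K) (input_store e) in
  evds e (output_edges n s) /\
  forall S, evds e S -> k * #|output_edges n s| <= k.+1 * #|S|.
Proof.
move=> k0 growth domK s.
have [sol all_dead] : solution k s /\ forall u, s 5 u != 0.
  rewrite /s /ptas run_seq; set s1 := run offsets _.
  have e1 : env s1 := offsets_env.
  have s10 : s1 0 0 = n by have [] := e1.
  have s15 u : s1 5 u = 0 by rewrite /s1 run_frame.
  have s12 (i : nat) : s1 2 i = 0 by rewrite /s1 run_frame.
  pose I s' := env s' /\ solution k s'.
  suff [] : I (run (PFor 6 (PIf (Read 5 (var 6)) PSkip (process k (3 * m) m K))) s1) /\
    forall u, run (PFor 6 (PIf (Read 5 (var 6)) PSkip (process k (3 * m) m K))) s1 5 u != 0.
    by move=> [].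
  apply: (@for_ind _ _ _ (fun i s' => I s' /\ forall u, u < i -> s' 5 u != 0)
    (fun s' => I s' /\ forall u, s' 5 u != 0)).
  - split=> //; split=> //; split=> [u w|]; first by rewrite /marked s12.
    exists finset.set0, 0; split; last exact: packing0.
      by move=> u; rewrite s15.
    rewrite muln0 leqn0 muln_eq0; apply/orP; right; rewrite cards_eq0.
    apply/eqP/finset.setP => f; rewrite finset.in_set0; apply/negbTE/negP.
    by move=> /imset2P[u w _]; rewrite inE s12.
  - move=> i s2; rewrite s10 => i_lt fr [[e2 sol2] dead2]; pose v := Ordinal i_lt.
    set s3 := update s2 6 0 i.
    have e3 : env s3 by apply: env_frame e2; rewrite /s3 update_other.
    have sol3 : solution k s3 := sol2.
    have s36 : s3 6 0 = v by [].
    have s35 : s3 5 = s2 5 by rewrite /s3 update_other.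
    have inner u : u < i.+1 -> u = v \/ u < i.
      rewrite ltnS leq_eqVlt => /orP[/eqP ui|]; last by right.
      by left; apply: val_inj.
    rewrite run_if; case: ifP => [d|/negbT/negPn/eqP d].
      by split=> // u /inner[->|/dead2]; rewrite ?s35.
    have [e4 sol4 mono dv] := process_invariant (domK v) k0 growth erefl e3 s36 sol3 d.
    by split=> // u /inner[->|/dead2 du] //; apply: mono; rewrite s35.
  - move=> s2 fr; rewrite s10 => -[[e2 sol2] dead2].
    split; first by split=> //; apply: env_frame e2; rewrite update_other.
    by move=> u; rewrite update_other // dead2.
have [me [U [N [dU kO [UN _]]]]] := sol.
split=> [|S [Se Sd]].
  split=> [|u].
    apply/fintype.subsetP => f /imset2P[u w _]; rewrite inE /= => /me euw ->.
    by apply/edgeP; exists (u, w).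
  have [[a b] mab pu] := dU u (all_dead u).
  exists [set a; b]; last by rewrite ev_dominatesE // me.
  by apply/imset2P; exists a b; rewrite ?inE.
by rewrite (leq_trans kO) // leq_mul2l UN // => u _; apply: Sd.
Qed.

End Correctness.

(** * Running time *)

Lemma wf_enum_tuples q body : (forall a, a \in writes body -> a < 13) ->
  wf body -> wf (enum_tuples q body).
Proof.
move=> body_lt wb; elim: q => //= q ->; rewrite !inE !negb_or cats0 /= andbT.
have fresh a : 13 + q.*2 <= a -> a \notin writes (enum_tuples q body).
  by move=> qa; apply/negP => /writes_enum[/body_lt|]; lia.
have sq : 13 + q.*2 <= src q by [].
have dq : 13 + q.*2 <= dst q by rewrite /dst; lia.
by rewrite !fresh //= /src /dst !andbT; lia.
Qed.

Lemma wf_level R r q q' : wf (level R r q q').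
Proof.
have wf_emit p : wf (emit p) by elim: p => //= p ->.
rewrite /= !wf_enum_tuples //=.
- by move=> a /(@writes_commit R r.+3 q'); rewrite !inE; lia.
- by rewrite wf_emit.
- by move=> a; rewrite /= !inE; lia.
Qed.

Lemma wf_ptas k R m K : wf (ptas k R m K).
Proof.
have levels_wf l : wf (levels k R l) /\ 6 \notin writes (levels k R l).
  elim: l => [|jq l [IH1 IH2]] //; split.
    by apply/andP; split; first exact: wf_level.
  rewrite -[levels _ _ _]/(PSeq _ (levels k R l)) -[writes _]/(_ ++ _).
  rewrite mem_cat negb_or IH2 andbT.
  by apply/negP => /writes_level[].
have bfs_wf l : wf (bfs_steps R l) by elim: l => //= l ->.
have bfs6 l : 6 \notin writes (bfs_steps R l).
  by elim: l => //= l IHl; rewrite mem_cat negb_or IHl.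
have [wl l6] := levels_wf [seq (j, q) | j <- iota 0 m, q <- iota 1 K].
by rewrite /= wl bfs_wf !(inE, mem_cat) (negbTE (bfs6 R)) (negbTE l6).
Qed.

Lemma depth_enum_tuples q body : depth (enum_tuples q body) = q.*2 + depth body.
Proof. by elim: q => //= q ->; rewrite maxn0 doubleS. Qed.

(** The deepest nest enumerates at most [2K] edges with two loops each and runs [check] or [kill]
    inside. *)
Lemma depth_level R r q q' K : q <= K -> q' <= K.*2 ->
  depth (level R r q q') <= 4 * K + 1.
Proof.
move=> qK qK'; have emit0 p : depth (emit p) = 0 by elim: p => //= p ->.
by rewrite /= !depth_enum_tuples /= emit0 /=; lia.
Qed.

Lemma cost_cover_count q : expr_cost (cover_count q (var 8)) = 16 * q + 1.
Proof. by elim: q => // q IHq /=; rewrite IHq; lia. Qed.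

Lemma weight_enum_tuples q body : weight (enum_tuples q body) = 51 * q + weight body.
Proof. by elim: q => //= q ->; lia. Qed.

Lemma weight_emit q : weight (emit q) = 8 * q + 1.
Proof. by elim: q => //= q ->; lia. Qed.

Lemma weight_level R r q q' : weight (level R r q q') <= 67 * q + 75 * q' + 200.
Proof. 
rewrite /= !weight_enum_tuples /= !cost_cover_count weight_emit. lia.
Qed.

Lemma weight_seq p q : weight (PSeq p q) = weight p + weight q.
Proof. by []. Qed.

Lemma depth_seq p q : depth (PSeq p q) = maxn (depth p) (depth q).
Proof. by []. Qed.

Section Time.
Variables (k m K : nat).
Hypotheses (k_gt0 : 0 < k) (m_gt0 : 0 < m) (mK : m <= K).

Let ps : seq (nat * nat) := [seq (j, q) | j <- iota 0 m, q <- iota 1 K].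

Let psP jq : jq \in ps -> jq.2 <= K /\ k.+1 * jq.2 %/ k <= K.*2.
Proof.
move=> /allpairsP[[j q] [_ /= + ->]]; rewrite mem_iota /= => qK.
split; first by lia.
rewrite -ltnS ltn_divLR //; nia.
Qed.

Lemma depth_ptas : depth (ptas k (3 * m) m K) <= 4 * K + 3.
Proof.
have levels_depth l : {subset l <= ps} -> depth (levels k (3 * m) l) <= 4 * K + 1.
  elim: l => [|jq l IHl] sub //.
  rewrite -[levels _ _ _]/(PSeq _ (levels k (3 * m) l)) depth_seq geq_max.
  have [qK qK'] := psP (sub _ (mem_head _ _)).
  rewrite depth_level //= IHl // => jq' h; apply: sub.
  by rewrite inE h orbT.
have bfs_depth l : depth (bfs_steps (3 * m) l) <= 2.
  by elim: l => //= l IHl; rewrite geq_max IHl.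
have := levels_depth ps (fun _ h => h); have := bfs_depth (3 * m).
rewrite /ptas /process /bfs -/ps.
set P := levels _ _ _; set B := bfs_steps _ _.
by rewrite /=; lia.
Qed.

Lemma weight_ptas : weight (ptas k (3 * m) m K) <= 2 ^ 10 * K.+1 ^ 3.
Proof.
have levels_weight l : {subset l <= ps} ->
    weight (levels k (3 * m) l) <= size l * (217 * K + 200) + 1.
  elim: l => [|jq l IHl] sub //.
  rewrite -[levels _ _ _]/(PSeq _ (levels k (3 * m) l)) weight_seq.
  have [qK qK'] := psP (sub _ (mem_head _ _)).
  have := weight_level (3 * m) (3 * jq.1) jq.2 (k.+1 * jq.2 %/ k).
  have : weight (levels k (3 * m) l) <= size l * (217 * K + 200) + 1.
    by apply: IHl => jq' h; apply: sub; rewrite inE h orbT.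
  rewrite -[size (_ :: _)]/(size l).+1 [(size l).+1 * _]mulSn; move: (_ %/ k) qK' => q' qK'.
  move: (size l * _) (jq.2) qK => x q qK.
  by move: (weight _) (weight _) => y z; lia.
have bfs_weight l : weight (bfs_steps (3 * m) l) <= 100 * l + 1.
  by elim: l => //= l IHl; lia.
have := levels_weight ps (fun _ h => h); have := bfs_weight (3 * m).
rewrite size_allpairs !size_iota /ptas /process /bfs -/ps.
set P := levels _ _ _; set B := bfs_steps _ _ => /= hx hy.
have mKK : m * K * (217 * K + 200) <= K * K * (217 * K + 200).
  by rewrite leq_mul2r leq_mul2r mK !orbT.
have -> : 2 ^ 10 = 1024 by [].
have -> : K.+1 ^ 3 = K.+1 * K.+1 * K.+1 by rewrite !expnS expn0 muln1 mulnA.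
by nia.
Qed.

(** For [N] at least 2 the constant factor is bounded by a power of [N] too, as [K + 1] is at most
    [2^K]. The exponents add up to [7K + 13], at most [20K] since [K] is positive. *)
Lemma ptas_cost N : 1 < N ->
  weight (ptas k (3 * m) m K) * N ^ depth (ptas k (3 * m) m K) <= N ^ (20 * K).
Proof.
move=> N1; have N0 : 0 < N by apply: ltnW.
have dN : N ^ depth (ptas k (3 * m) m K) <= N ^ (4 * K + 3).
  by rewrite leq_pexp2l ?depth_ptas.
have wN : weight (ptas k (3 * m) m K) <= N ^ (10 + K * 3).
  rewrite (leq_trans weight_ptas) // expnD leq_mul //.
    by rewrite leq_exp2r.
  by rewrite expnM leq_exp2r // (leq_trans (ltn_expl K (isT : 1 < 2))) // leq_exp2r //; lia.
rewrite (leq_trans (leq_mul wN dN)) // -expnD leq_pexp2l //; lia.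
Qed.

End Time.

(** * The growth condition on the parameters *)

Lemma leq_double_expS k : 0 < k -> 2 * k ^ k <= k.+1 ^ k.
Proof.
(* Bernoulli's inequality [1 + j/k <= (1 + 1/k)^j], cleared of denominators; [j = k] gives the
   factor 2. *)
move=> k0; have bernoulli j : k ^ j * (k + j) <= k * k.+1 ^ j.
  elim: j => [|j IHj]; first by rewrite addn0 !expn0 mul1n muln1.
  rewrite !expnS; apply: (@leq_trans (k ^ j * (k + j) * k.+1)).
    rewrite [k * k ^ j]mulnC -!mulnA leq_mul2l; apply/orP; right; nia.
  by rewrite [k * (_ * _)]mulnCA [leqRHS]mulnC leq_mul2r IHj orbT.
rewrite -(leq_pmul2l k0) (leq_trans _ (bernoulli k)) //.
by move: (k ^ k) => x; nia.
Qed.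

(** For [m = 24kL] the power [(1 + 1/k)^m] is at least [2^(24L)], whereas the number of cells
    [(12m + 1)^2] is at most [2^(18 + 4L)], which is smaller as [L >= 1]. *)
Lemma growth_bound k L : 0 < L -> 0 < k -> k <= 2 ^ L ->
  (4 * (3 * (24 * (k * L)))).+1 ^ 2 * k ^ (24 * (k * L)) < k.+1 ^ (24 * (k * L)).
Proof.
move=> L0 k0 kL; have -> : 24 * (k * L) = k * (24 * L) by lia.
have h1 : 2 ^ (24 * L) * k ^ (k * (24 * L)) <= k.+1 ^ (k * (24 * L)).
  by rewrite !(expnM k) !(expnM k.+1) -expnMn leq_exp2r ?leq_double_expS //; lia.
apply: leq_trans h1; rewrite ltn_pmul2r ?expn_gt0 ?k0 //.
have LL : L <= 2 ^ L by apply/ltnW/ltn_expl.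
have h2 : (4 * (3 * (k * (24 * L)))).+1 <= 2 ^ 9 * (2 ^ L * 2 ^ L).
  (* 289 is [12 * 24 + 1], and both [k] and [L] are at most [2^L]. *)
  apply: (@leq_trans (289 * (k * L))); first by nia.
  rewrite leq_mul ?leq_mul //.
have h3 : (4 * (3 * (k * (24 * L)))).+1 ^ 2 <= 2 ^ (18 + 4 * L).
  rewrite (_ : 18 + 4 * L = (9 + (L + L)) * 2); last by lia.
  by rewrite expnM leq_exp2r // !expnD.
by apply: leq_ltn_trans h3 _; rewrite ltn_exp2l //; lia.
Qed.

(** * Choice of the parameters *)

Local Open Scope classical_set_scope.
Local Open Scope ring_scope.

Section Accuracy.
Variable R : realType.
Implicit Types eps : R.

(** The parameter [k], with [1/k <= eps]. Adding 2 makes it at least 2, so that [log_of] is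
    positive. *)
Definition ratio_of eps : nat := (Num.truncn eps^-1).+2.
Definition log_of eps : nat := up_log 2 (ratio_of eps).
Definition levels_of eps : nat := (24 * (ratio_of eps * log_of eps))%N.
Definition tuple_bound eps : nat := ((4 * (3 * levels_of eps)).+1 ^ 2)%N.

Lemma log_of_gt0 eps : (0 < log_of eps)%N.
Proof. by rewrite up_log_gt0. Qed.

Lemma ratio_of_inv eps : 0 < eps -> (ratio_of eps)%:R^-1 <= eps.
Proof.
move=> eps0; have e0 : 0 < eps^-1 by rewrite invr_gt0.
rewrite -[leRHS]invrK lef_pV2 ?posrE ?ltr0n //.
have := truncn_itv (ltW e0) => /andP[_ /ltW h].
by rewrite (le_trans h) // ler_nat.
Qed.

Lemma ratio_of_le eps : 0 < eps -> eps <= 1 -> (ratio_of eps)%:R <= 3 * eps^-1.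
Proof.
move=> eps0 eps1; have e1 : 1 <= eps^-1 by rewrite invf_ge1.
have := truncn_itv (le_trans ler01 e1) => /andP[h _].
by rewrite /ratio_of -addn2 natrD; lra.
Qed.

(** With [k] and [L] for [ratio_of eps] and [log_of eps], the chain [2^(L-1) < k <= 3/eps <= eps^-2]
    gives [(L-1) ln 2 <= 2 ln (1/eps)]; the missing [ln 2] is at most [ln (1/eps)]. *)
Lemma log_of_le eps : 0 < eps -> eps <= 3^-1 ->
  (log_of eps)%:R <= 3 / ln 2 * ln (eps^-1).
Proof.
move=> eps0 eps3.
have l2 : 0 < ln 2 :> R by rewrite ln_gt0 // ltr1n.
have e3 : 3 <= eps^-1 by rewrite -[leLHS]invrK lef_pV2 ?posrE ?invr_gt0.
have k0 : 0 < (ratio_of eps)%:R :> R by rewrite ltr0n.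
have h : ln (2 ^+ (log_of eps).-1) <= ln (eps^-1 ^+ 2).
  rewrite ler_ln ?posrE ?exprn_gt0 ?invr_gt0 //.
  apply: (@le_trans _ _ (ratio_of eps)%:R).
    by rewrite -natrX ler_nat ltnW // up_log_gtn.
  rewrite (le_trans (ratio_of_le eps0 _)) //; first by lra.
  by rewrite expr2 ler_wpM2r // ltW // invr_gt0.
rewrite !lnXn ?invr_gt0 // in h.
have h2 : ln 2 <= ln (eps^-1) by rewrite ler_ln ?posrE ?invr_gt0 //; lra.
rewrite mulrAC ler_pdivlMr //.
rewrite -(prednK (log_of_gt0 eps)) -natr1 mulrDl mul1r mulr_natl.
by move: h; rewrite [in leRHS]mulr2n; lra.
Qed.

Lemma natr_square_le (a b : nat) (x : R) :
  b%:R <= x -> (a * b ^ 2)%N%:R <= a%:R * x ^+ 2.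
Proof.
move=> bx; rewrite natrM natrX ler_wpM2l ?ler0n //.
by rewrite ler_sqr // nnegrE ?ler0n // (le_trans _ bx).
Qed.

(** The factor 9 is the product of the constants 3 in the bounds on [ratio_of] and [log_of]; 289
    again absorbs the successor. *)
Lemma tuple_bound_le eps : 0 < eps -> eps <= 3^-1 ->
  (20 * tuple_bound eps)%N%:R <=
    20 * (289 * (9 / ln 2)) ^+ 2 * (eps^-1 * ln (eps^-1)) ^+ 2.
Proof.
move=> eps0 eps3; set c := _ * ln (_^-1).
have hk : (ratio_of eps)%:R <= 3 * eps^-1 by apply: ratio_of_le => //; lra.
have hL := log_of_le eps0 eps3.
have kL : (ratio_of eps * log_of eps)%N%:R <= 9 / ln 2 * c.
  have -> : 9 / ln 2 * c = (3 * eps^-1) * (3 / ln 2 * ln (eps^-1)).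
    by rewrite /c; ring.
  by rewrite natrM ler_pM ?ler0n.
rewrite -[leRHS]mulrA -exprMn -[289 * _ * c]mulrA.
apply: natr_square_le.
have le289 : ((4 * (3 * levels_of eps)).+1 <= 289 * (ratio_of eps * log_of eps))%N.
  have : (0 < ratio_of eps * log_of eps)%N by rewrite muln_gt0 log_of_gt0.
  rewrite /levels_of; move: (_ * log_of eps)%N => x; lia.
rewrite -(ler_nat R) natrM in le289; apply: le_trans le289 _.
by rewrite ler_wpM2l ?ler0n.
Qed.

End Accuracy.

Theorem theorem15 (R : realType) :
  let c := fun eps : R => eps^-1 * ln (eps^-1) in
  exists p : R -> R,
    p =O_ (0^'+) (fun eps : R => c eps ^+ 2) /\
    forall eps : R, 0 < eps ->
      exists P : cmd,
        forall (n : nat) (e : rel 'I_n),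
          simple_graph e -> unit_disk_graph R e -> no_isolated e ->
          exists (t : nat) (s : store),
            [/\ exec P (input_store e) t s,
                evds e (output_edges n s),
                (forall S : {set {set 'I_n}}, minimum_evds e S ->
                  #|output_edges n s|%:R <= (1 + eps) * #|S|%:R) &
                (0 < n)%N -> t%:R <= n%:R `^ p eps].
Proof.
(* The exponent [20K] of [ptas_cost], at the chosen parameters. *)
move=> c; exists (fun eps => (20 * tuple_bound eps)%N%:R); split.
  apply/eqO_exP; exists (20 * (289 * (9 / ln 2)) ^+ 2).
    have l2 : 0 < ln 2 :> R by rewrite ln_gt0 // ltr1n.
    by rewrite mulr_gt0 ?exprn_gt0 ?(mulr_gt0 _ (divr_gt0 _ l2)) ?ltr0n.
  near=> eps.
  have eps0 : 0 < eps by near: eps; apply: nbhs_right_gt.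
  have eps3 : eps <= 3^-1 by apply: ltW; near: eps; apply: nbhs_right_lt.
  by rewrite ger0_norm ?ler0n // ger0_norm ?sqr_ge0 // tuple_bound_le.
move=> eps eps0.
pose k := ratio_of eps; pose m := levels_of eps; pose K := tuple_bound eps.
exists (compile (ptas k (3 * m) m K)) => n e e_simple e_udg e_iso.
have k0 : (0 < k)%N by [].
have m0 : (0 < m)%N by rewrite !muln_gt0 log_of_gt0.
have mK : (m <= K)%N by rewrite /K /tuple_bound -/m expnS expn1; nia.
have growth : (K * k ^ m < k.+1 ^ m)%N.
  by apply: growth_bound; rewrite ?log_of_gt0 // up_logP.
have domK v r : (r <= 3 * m)%N -> dom e K (ball e v r).
  move=> rm; have [t te tcov] := udg_ball_dom v (3 * m) e_simple e_iso e_udg.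
  by exists t => // a /(fintype.subsetP (ball_mono e v rm)); apply: tcov.
have [sol opt] := ptas_correct e_simple e_iso k0 growth domK.
(* The bound on the loop length has to be positive, while the graph may be empty. *)
have [||t tle et] := @compileP (maxn n 1) _ (input_store e) (wf_ptas k (3 * m) m K).
- by rewrite /= leq_maxl.
- by rewrite leq_maxr.
exists t, (run (ptas k (3 * m) m K) (input_store e)); split=> //.
  move=> S [evS _]; have := opt S evS.
  rewrite -(ler_nat R) !natrM -natr1 => h.
  have kR : 0 < k%:R :> R by rewrite ltr0n.
  have ke := ratio_of_inv eps0; rewrite -/k in ke.
  apply: (@le_trans _ _ ((1 + k%:R^-1) * #|S|%:R)); last by rewrite ler_wpM2r // lerD2l.
  rewrite -(ler_pM2l kR) (le_trans h) // mulrA le_eqVlt; apply/orP; left.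
  by apply/eqP; field; rewrite gt_eqF.
(* A single vertex would be isolated, so the cost bound for [N >= 2] applies with [N = n]. *)
move=> n0; have n1 : (1 < n)%N.
  rewrite ltn_neqAle n0 andbT; apply/eqP => n1.
  have [w] := e_iso (Ordinal n0); have -> : w = Ordinal n0.
    by apply: val_inj => /=; have := ltn_ord w; lia.
  by have [_ ->] := e_simple.
rewrite powR_mulrn ?ler0n // -natrX ler_nat.
rewrite (maxn_idPl n0) in tle.
exact: leq_trans tle (ptas_cost k0 m0 mK n1).
Unshelve. all: by end_near.
Qed.
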